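(* Consider the strict $(1:1)$ Avoider-Enforcer vertex $K_3$-game. Let $\mathcal E^A_{K_3}$ (resp. $\mathcal E^E_{K_3}$) be the graph property of being Enforcer's win in this game when the order of play is such that Avoider (resp. Enforcer) makes the last move, i.e. claims the last free vertex (this is determined by which player moves first and by the parity of the number of vertices). For the random graph process $\tilde G$ on $[n]$, w.h.p. $\tau(\tilde G,\mathcal E^A_{K_3})=\tau(\tilde G,\mathcal G_{DD})$ and $\tau(\tilde G,\mathcal E^E_{K_3})=\tau(\tilde G,\mathcal G_{2DD})$.
   Context: The strict $(1:1)$ Avoider-Enforcer vertex $K_3$-game on a graph $G$: Avoider and Enforcer alternately claim exactly one previously unclaimed vertex of $G$ each until all vertices are claimed; Avoider loses if the subgraph of $G$ induced by his vertices contains a triangle, and wins otherwise. The random graph process $\tilde G=(G_i)$ on $[n]$ adds the edges of $K_n$ one by one in uniformly random order; $\tau(\tilde G,\mathcal P)=\min\{i:G_i\in\mathcal P\}$. A double diamond $DD$ is the graph on vertices $x,y_1,z_1,z_2,y_2,z_3,z_4$ with edges $xy_1,xz_1,xz_2,y_1z_1,y_1z_2,xy_2,xz_3,xz_4,y_2z_3,y_2z_4$. $\mathcal G_{kF}$ is the property of containing $k$ (possibly intersecting) copies of $F$, $\mathcal G_F=\mathcal G_{1F}$. ''W.h.p.'' means with probability tending to 1 as $n\to\infty$. *)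

(* Defs.v *)
From HB Require Import structures.
From mathcomp Require Import all_boot all_order all_fingroup all_algebra.
Set Implicit Arguments. Unset Strict Implicit. Unset Printing Implicit Defensive.
Import GRing.Theory Num.Theory.

(* A contains a triangle of the graph e (e irreflexive, so x,y,z distinct). *)
Definition has_triangle (T : finType) (e : rel T) (A : {set T}) : bool :=
  [exists x : T, exists y : T, exists z : T,
     [&& x \in A, y \in A, z \in A, e x y, e y z & e x z]].

(* ewin_aux e lastA k A F : Enforcer wins from the position where Avoider
   owns A, the free vertices are F (with k = #|F|), play continues
   alternately one vertex per move, and the player who claims the last free
   vertex is Avoider iff lastA.  With k free vertices left, the player to
   move is the last mover iff k is odd.  Enforcer's own vertices are
   irrelevant for the outcome, so they are not recorded. *)
Fixpoint ewin_aux (T : finType) (e : rel T) (lastA : bool) (k : nat)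
    (A F : {set T}) : bool :=
  match k with
  | 0 => has_triangle e A
  | k'.+1 =>
      if odd k == lastA then
        [forall v in F, ewin_aux e lastA k' (v |: A) (F :\ v)]
      else
        [exists v in F, ewin_aux e lastA k' A (F :\ v)]
  end.

Definition enforcer_win (T : finType) (lastA : bool) (e : rel T) : bool :=
  ewin_aux e lastA #|T| set0 setT.

Definition EA_K3 (T : finType) (e : rel T) : bool := enforcer_win true e.
Definition EE_K3 (T : finType) (e : rel T) : bool := enforcer_win false e.

Definition embeddingb (V T : finType) (eF : rel V) (eG : rel T)
    (phi : {ffun V -> T}) : bool :=
  injectiveb phi && [forall x, forall y, eF x y ==> eG (phi x) (phi y)].

Definition copy_edges (V T : finType) (eF : rel V) (phi : {ffun V -> T})
    : {set T * T} :=
  [set (phi xy.1, phi xy.2) | xy in [set xy : V * V | eF xy.1 xy.2]].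

(* G_{kF}: G contains k (possibly intersecting, pairwise distinct) copies
   of F, a copy being a subgraph of G isomorphic to F. *)
Definition contains_k_copies (V T : finType) (eF : rel V) (k : nat)
    (eG : rel T) : bool :=
  [exists S : {set {set T * T}},
     (k <= #|S|) &&
     [forall B in S, [exists phi : {ffun V -> T},
                        embeddingb eF eG phi && (B == copy_edges eF phi)]]].

(* vertices: x=0, y1=1, z1=2, z2=3, y2=4, z3=5, z4=6 *)
Definition DD_edges : seq (nat * nat) :=
  [:: (0,1); (0,2); (0,3); (1,2); (1,3); (0,4); (0,5); (0,6); (4,5); (4,6)].

Definition DD : rel 'I_7 := fun u v =>
  ((nat_of_ord u, nat_of_ord v) \in DD_edges) ||
  ((nat_of_ord v, nat_of_ord u) \in DD_edges).

Definition Kedge (n : nat) : finType := {xy : 'I_n * 'I_n | (xy.1 < xy.2)%N}.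

(* A uniformly random ordering of the edges of K_n is encoded by a uniformly
   random permutation p of the edges: edge f is the (enum_rank (p f))-th
   edge added (counting from 0).  G_i consists of the first i edges. *)
Definition proc_graph (n : nat) (p : {perm Kedge n}) (i : nat) : rel 'I_n :=
  fun x y => [exists f : Kedge n,
                ((val f == (x, y)) || (val f == (y, x))) &&
                (enum_rank (p f) < i)%N].

(* tau(G~, P) = min {i : G_i in P}; i ranges over 0..N with N = |E(K_n)|;
   if no G_i has P the value N+1 is returned (a convention; irrelevant for
   the properties considered, which hold for K_n once n >= 7). *)
Definition hitting_time (n : nat) (P : rel 'I_n -> bool) (p : {perm Kedge n})
    : nat :=
  find (fun i => P (proc_graph p i)) (iota 0 (#|Kedge n|).+1).

Definition whp (good : forall n : nat, {perm Kedge n} -> bool) : Prop :=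
  forall eps : rat, (0 < eps)%R -> exists N : nat, forall n : nat, (N <= n)%N ->
    (1 - eps <=
      #|[set p : {perm Kedge n} | good n p]|%:R / #|{perm Kedge n}|%:R)%R.

(* Main.v *)
(** The double diamond DD has 7 vertices and 10 edges, so copies of DD appear
    around M = n^(13/10) edges, and slightly beyond that point w.h.p. every set of
    at most 23 vertices still spans at most 10/7 times as many edges as vertices
    (union bound), while two copies of DD are present (second moment).  In such a
    sparse graph the game is decided by the copies of DD.

    Avoider survives when disjoint pairs of vertices hit all triangles: he never
    takes both vertices of a pair.  In a sparse graph such a pairing exists on
    every DD-free vertex set.  In a minimal counterexample, grow a set from a
    diamond (or from a triangle, if there is none) by triangles meeting it in an
    edge or in a vertex.  Each step lowers 20 |S| - 14 e(S) >= 0, by 8 or by 2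
    respectively, and a growth ending with a triangle attached at a vertex leaves
    a pair that can be matched and deleted; few small configurations remain, all
    of them matchable except DD.

    Enforcer wins on DD if Avoider moves first there, and Avoider then also makes
    the last move on it; so, answering on the board on which Avoider moves,
    Enforcer wins with one copy of DD if Avoider moves last overall, and with two
    if he moves last himself.  Copies of DD in a sparse graph are induced and no
    triangle leaves them, so distinct copies are disjoint.  If Enforcer is last
    and there is only one copy, Avoider waits until Enforcer claims one of its
    vertices, after which the remaining six can be paired. *)

Require Import Defs.
From HB Require Import structures.
From mathcomp Require Import all_boot all_order all_fingroup all_algebra.
From mathcomp Require Import zify ring lra.
Set Implicit Arguments. Unset Strict Implicit. Unset Printing Implicit Defensive.
Import GRing.Theory Num.Theory.

(** * Pairing strategies and boards *)

Section Pairings.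

Variable T : finType.
Implicit Types (P Q F A B D W : {set T}) (s : T -> T).

(** A perfect matching of [P], given as a fixed-point-free involution. The values of [s] off [P] are
    arbitrary, so pairings of disjoint sets combine by a case distinction. *)
Definition pairing P s : Prop :=
  forall x, x \in P -> [/\ s x \in P, s x != x & s (s x) = x].

(** A whole pair lies in the triple, so a player who takes at most one vertex of each pair never
    owns it. *)
Definition hit P s (x y z : T) : Prop :=
  exists2 t, t \in P & (t \in [:: x; y; z]) && (s t \in [:: x; y; z]).

Lemma pairing0 s : pairing set0 s.
Proof. by move=> x; rewrite inE. Qed.

Lemma pairingD2 P s a : a \in P -> pairing P s -> pairing (P :\ a :\ s a) s.
Proof.
move=> aP sP x; rewrite !inE => /and3P[xsa xa xP].
have [sxP sxx ssx] := sP x xP; have [_ _ ssa] := sP a aP.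
split=> //; rewrite sxP andbT; apply/andP; split.
  by apply: contra xa => /eqP E; rewrite -ssx E ssa.
by apply: contra xsa => /eqP <-; rewrite ssx.
Qed.

Lemma pairingU P Q s s' : [disjoint P & Q] -> pairing P s -> pairing Q s' ->
  pairing (P :|: Q) (fun x => if x \in P then s x else s' x).
Proof.
move=> dPQ sP sQ x; rewrite inE; case xP: (x \in P) => /=.
  by move=> _; have [sxP ? ?] := sP x xP; split; rewrite ?inE ?sxP.
move=> xQ; have [s'Q ? ?] := sQ x xQ; split=> //; first by rewrite inE s'Q orbT.
suff /negbTE -> : s' x \notin P by [].
by apply: contraL s'Q => s'P; rewrite (disjointFr dPQ s'P).
Qed.

Lemma cardsD2 P a b : a \in P -> b \in P -> b != a ->
  #|P| = #|P :\ a :\ b|.+2.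
Proof. by move=> aP bP ba; rewrite (cardsD1 a) aP (cardsD1 b (P :\ a)) !inE ba bP. Qed.

Lemma even_pairing P s : pairing P s -> ~~ odd #|P|.
Proof.
move: {2}#|P| (leqnn #|P|) => m; elim/ltn_ind: m P => m IH P Pm sP.
have [->|[a aP]] := set_0Vmem P; first by rewrite cards0.
have [saP saa _] := sP a aP.
have E := cardsD2 aP saP saa; rewrite E /= negbK.
by apply: (IH _ _ _ (leqnn _) (pairingD2 aP sP)); rewrite E in Pm; lia.
Qed.

Lemma pairing_of_even P : ~~ odd #|P| -> exists s, pairing P s.
Proof.
move: {2}#|P| (leqnn #|P|) => m; elim/ltn_ind: m P => m IH P Pm evP.
have [->|[a aP]] := set_0Vmem P; first by exists id; exact: pairing0.
have : 0 < #|P :\ a| by move: evP; rewrite (cardsD1 a) aP add1n /=; case: #|_|.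
case/card_gt0P=> b; rewrite !inE => /andP[ba bP].
have E := cardsD2 aP bP ba.
have [||s sP] := IH #|P :\ a :\ b| _ (P :\ a :\ b) (leqnn _).
- by rewrite E in Pm; lia.
- by rewrite E /= negbK in evP.
exists (fun x => if x \in [set a; b] then (if x == a then b else a) else s x).
have -> : P = [set a; b] :|: (P :\ a :\ b).
  by apply/setP=> x; rewrite !inE; case: eqP => [->|]; case: eqP => [->|]; rewrite ?aP ?bP.
apply: pairingU => //.
  by rewrite -setI_eq0; apply/eqP/setP=> x; rewrite !inE; case: (x == a); case: (x == b).
move=> x; rewrite !inE => /orP[] /eqP ->; rewrite ?eqxx ?(negbTE ba) ?eqxx ?orbT //.
by split=> //; rewrite eq_sym.
Qed.

(** Both sets are even, so the vertices of [F] outside [P] can be paired arbitrarily. *)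
Lemma extend_pairing P F s : P \subset F -> pairing P s -> ~~ odd #|F| ->
  exists2 s', pairing F s' & {in P, s' =1 s}.
Proof.
move=> PF sP evF.
have : ~~ odd #|F :\: P|.
  rewrite cardsD (setIidPr PF) oddB ?subset_leq_card //.
  by rewrite (negbTE evF) (negbTE (even_pairing sP)).
case/pairing_of_even=> s' s'P.
exists (fun x => if x \in P then s x else s' x); last by move=> x ->.
rewrite -(setID F P) (setIidPr PF); apply: pairingU => //.
by rewrite -setI_eq0; apply/eqP/setP=> x; rewrite !inE; case: (x \in P).
Qed.

Lemma hit_sub P Q s s' x y z : P \subset Q -> {in P, s' =1 s} ->
  hit P s x y z -> hit Q s' x y z.
Proof. by move=> PQ E [t tP H]; exists t; [exact: (subsetP PQ)|rewrite E]. Qed.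

Variable e : rel T.

Lemma has_triangleP A :
  reflect (exists x y z, [/\ x \in A, y \in A & z \in A] /\ [/\ e x y, e y z & e x z])
          (has_triangle e A).
Proof.
apply: (iffP existsP) => [[x /existsP[y /existsP[z /and5P[? ? ? ? /andP[]]]]]|].
  by exists x, y, z.
move=> [x [y [z [[? ? ?] [? ? ?]]]]]; exists x; apply/existsP; exists y.
by apply/existsP; exists z; apply/and5P; split=> //; apply/andP.
Qed.

Lemma sub_has_triangle A B : A \subset B -> has_triangle e A -> has_triangle e B.
Proof.
move=> /subsetP AB /has_triangleP[x [y [z [[xA yA zA] E]]]].
by apply/has_triangleP; exists x, y, z; split=> //; split; apply: AB.
Qed.

Lemma ewin_auxSA l k A F : odd k.+1 = l ->
  ewin_aux e l k.+1 A F = [forall v in F, ewin_aux e l k (v |: A) (F :\ v)].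
Proof. by move=> <-; rewrite [LHS]/= eqxx. Qed.

Lemma ewin_auxSE l k A F : odd k = l ->
  ewin_aux e l k.+1 A F = [exists v in F, ewin_aux e l k A (F :\ v)].
Proof. by move=> <-; rewrite [LHS]/=; case: (odd k). Qed.

Definition all_hit W P s : Prop :=
  forall x y z, x \in W -> y \in W -> z \in W -> e x y -> e y z -> e x z ->
  hit P s x y z.

Lemma hitD2 W P s v x y z : pairing P s -> v \in P -> v \notin W ->
  x \in W -> y \in W -> z \in W -> hit P s x y z -> hit (P :\ v :\ s v) s x y z.
Proof.
move=> sP vP vW xW yW zW [t tP /andP[t3 st3]].
have nv u : u \in [:: x; y; z] -> u != v.
  by move=> u3; apply: contraNneq vW => <-; move: u3; rewrite !inE => /or3P[] /eqP ->.
exists t; last by rewrite t3.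
rewrite !inE tP nv // andbT andbT; apply: contraTneq (nv _ st3) => ->.
by have [_ _ ->] := sP v vP; rewrite eqxx.
Qed.

(** Enforcer is to move, and Avoider answers with the partner of the claimed vertex. It stays true
    that every triangle on [A :|: F] contains a free pair, and at the end no free pair is left. *)
Lemma Avoider_pairing_last h A F s : #|F| = h.*2 -> [disjoint A & F] ->
  pairing F s -> all_hit (A :|: F) F s -> ~~ ewin_aux e true h.*2 A F.
Proof.
elim: h A F => [|h IH] A F cF dAF sF H.
  apply/negP => /= /has_triangleP[x [y [z [[xA yA zA] [e1 e2 e3]]]]].
  have [||| t] := H x y z _ _ _ e1 e2 e3; rewrite ?inE ?xA ?yA ?zA //.
  by rewrite (cards0_eq cF) inE.
have o1 : odd h.*2.+1 = true by rewrite /= odd_double.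
rewrite doubleS (ewin_auxSE _ _ o1); apply/negP => /existsP[v /andP[vF]].
rewrite (ewin_auxSA _ _ o1) => /forallP H2.
have [svF svv ssv] := sF v vF.
have E := cardsD2 vF svF svv.
move: (H2 (s v)); rewrite !inE svv svF; apply/negP; apply: IH.
- by move: cF; rewrite E doubleS => -[].
- rewrite -setI_eq0; apply/eqP/setP=> x; rewrite !inE.
  case: (eqVneq x (s v)) => //= _; case xA: (x \in A) => //=.
  by rewrite (disjointFr dAF xA) andbF.
- exact: pairingD2.
- have vN : v \notin s v |: A :|: F :\ v :\ s v.
    by rewrite !inE eqxx /= andbF orbF eq_sym (negbTE svv) (disjointFl dAF vF).
  have sW : s v |: A :|: F :\ v :\ s v \subset A :|: F.
    apply/subsetP=> x; rewrite !inE => /orP[/orP[/eqP->|->]|/and3P[_ _ ->]] //;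
    by rewrite ?svF orbT.
  move=> x y z xW yW zW e1 e2 e3; apply: (hitD2 sF vF vN) => //.
  by apply: H => //; apply: (subsetP sW).
Qed.

(* When Enforcer moves last he opens a phase by claiming a vertex of D, after
   which the remaining free vertices are paired; Avoider then splits a pair
   {a, b}, and b takes over the role of D. *)
Lemma Avoider_pairing_notlast h A F D s : #|F| = h.*2.+1 -> [disjoint A & F] ->
  D \subset F -> pairing (F :\: D) s ->
  (forall v, v \in D -> exists2 s', pairing (D :\ v) s' &
     forall x y z, x \in (A :|: F) :\ v -> y \in (A :|: F) :\ v ->
       z \in (A :|: F) :\ v -> e x y -> e y z -> e x z ->
       hit (F :\: D) s x y z \/ hit (D :\ v) s' x y z) ->
  ~~ ewin_aux e false h.*2.+1 A F.
Proof.
elim: h A F D s => [|h IH] A F D s cF dAF DF sF H; rewrite ewin_auxSE ?odd_double //;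
  apply/negP => /existsP[v /andP[vF]].
  (* Only one free vertex is left. It lies in [D], since otherwise its partner would be free as
     well. *)
  case vD: (v \in D); last first.
    have vFD : v \in F :\: D by rewrite inE vD.
    have [svF svv _] := sF v vFD; rewrite inE in svF; case/andP: svF => _ svF.
    by move: (cardsD2 vF svF svv); rewrite cF.
  move=> /has_triangleP[x [y [z [[xA yA zA] [e1 e2 e3]]]]].
  have [s' _ H'] := H v vD.
  have AW u : u \in A -> u \in (A :|: F) :\ v.
    move=> uA; rewrite !inE uA andbT; apply: contraTneq uA => ->.
    by rewrite (disjointFl dAF vF).
  have F0 : F :\ v = set0 by apply: cards0_eq; move: cF; rewrite (cardsD1 v) vF => -[].
  have N t : t \in F -> t != v -> False.
    by move=> tF tv; have := in_set0 t; rewrite -F0 !inE tF tv.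
  have [[t]|[t]] := H' x y z (AW _ xA) (AW _ yA) (AW _ zA) e1 e2 e3; rewrite !inE.
    by case/andP=> tD tF; case: (N t tF); apply: contraNneq tD => ->.
  by case/andP=> tv tD; case: (N t (subsetP DF _ tD) tv).
have o2 : odd h.*2.+2 = false by rewrite /= odd_double.
rewrite doubleS (ewin_auxSA _ _ o2) => /forallP H2; case vD: (v \in D).
  have [s' s'P H'] := H v vD.
  pose t x := if x \in F :\: D then s x else s' x.
  have EF : F :\ v = (F :\: D) :|: (D :\ v).
    apply/setP=> x; rewrite !inE; case: (eqVneq x v) => [->|] /=; first by rewrite vD.
    by move=> _; case xD: (x \in D) => //=; rewrite ?(subsetP DF _ xD) ?orbF.
  have dd : [disjoint F :\: D & D :\ v].
    by rewrite -setI_eq0; apply/eqP/setP=> x; rewrite !inE; case: (x \in D); rewrite ?andbF.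
  have tP : pairing (F :\ v) t by rewrite EF; exact: pairingU.
  have Ht : all_hit (A :|: F :\ v) (F :\ v) t.
    have AW u : u \in A :|: F :\ v -> u \in (A :|: F) :\ v.
      rewrite !inE => /orP[uA|/andP[-> ->]]; last by rewrite orbT.
      by rewrite uA andbT; apply: contraTneq uA => ->; rewrite (disjointFl dAF vF).
    move=> x y z /AW xW /AW yW /AW zW e1 e2 e3; rewrite EF.
    have [|] := H' x y z xW yW zW e1 e2 e3; apply: hit_sub; rewrite ?subsetUl ?subsetUr //.
      by move=> u; rewrite /t => ->.
    by move=> u uD; rewrite /t (disjointFl dd uD).
  have cFv : #|F :\ v| = h.*2.+2 by move: cF; rewrite (cardsD1 v) vF => -[].
  have /card_gt0P[a aF] : 0 < #|F :\ v| by rewrite cFv.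
  have [taF taa tta] := tP a aF.
  move: (H2 a); rewrite aF; apply/negP.
  apply: (IH _ _ [set t a] t).
  - by move: cFv; rewrite (cardsD1 a) aF => -[].
  - rewrite -setI_eq0; apply/eqP/setP=> x; rewrite !inE.
    case: (eqVneq x a) => //= _; case xA: (x \in A) => //=.
    by rewrite (disjointFr dAF xA) andbF.
  - by rewrite sub1set in_setD1 taa taF.
  - exact: pairingD2.
  - move=> w; rewrite inE => /eqP ->; exists t.
      by move=> x; rewrite !inE => /andP[/negbTE ->].
    (* Once Enforcer claims [t a], only triangles avoiding it matter, and these are hit by pairs
       other than [{a, t a}]. *)
    move=> x y z xW yW zW e1 e2 e3; left.
    have aP : t a \in F :\ v by [].
    have := @hitD2 (A :|: F :\ v :\ t a) (F :\ v) t (t a) x y z tP taF.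
    rewrite tta.
    have -> : F :\ v :\ t a :\ a = F :\ v :\ a :\: [set t a].
      by apply/setP=> u; rewrite !inE; case: (u == a); rewrite ?andbF.
    have taA : t a \notin A.
      by move: taF; rewrite !inE => /andP[_ taF]; rewrite (disjointFl dAF taF).
    have sW u : u \in (a |: A :|: F :\ v :\ a) :\ t a -> u \in A :|: F :\ v :\ t a.
      rewrite !inE; case: (eqVneq u a) => [->|] //=; move: aF taa; rewrite !inE.
        by move=> /andP[-> ->]; rewrite eq_sym => ->; rewrite orbT.
      by move=> _ _ _ /andP[-> ].
    have sW2 u : u \in A :|: F :\ v :\ t a -> u \in A :|: F :\ v.
      by rewrite !inE => /orP[->//|/and3P[_ -> ->]]; rewrite orbT.
    apply=> //; do ?[exact: sW].
      by rewrite !inE eqxx (negbTE taA).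
    by apply: Ht => //; apply/sW2/sW.
have vFD : v \in F :\: D by rewrite inE vD.
have [svF svv ssv] := sF v vFD.
have svF' : s v \in F by move: svF; rewrite inE => /andP[].
have svD : s v \notin D by move: svF; rewrite inE => /andP[].
have E := cardsD2 vF svF' svv.
move: (H2 (s v)); rewrite !inE svv svF'; apply/negP.
have EFD : F :\ v :\ s v :\: D = (F :\: D) :\ v :\ s v.
  by apply/setP=> x; rewrite !inE; case: (x \in D); rewrite ?andbF.
apply: (IH _ _ D s).
- by move: cF; rewrite E doubleS => -[].
- rewrite -setI_eq0; apply/eqP/setP=> x; rewrite !inE.
  case: (eqVneq x (s v)) => //= _; case xA: (x \in A) => //=.
  by rewrite (disjointFr dAF xA) andbF.
- apply/subsetP=> x xD; rewrite !inE (subsetP DF) // andbT; apply/andP; split.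
    by apply: contraTneq xD => ->.
  by apply: contraTneq xD => ->; rewrite vD.
- by rewrite EFD; apply: pairingD2.
- move=> w wD; have [s' s'P H'] := H w wD; exists s' => //.
  have vN : v \notin (s v |: A :|: F :\ v :\ s v) :\ w.
    by rewrite !inE eqxx (eq_sym v (s v)) (negbTE svv) (disjointFl dAF vF) !andbF.
  have sW u : u \in (s v |: A :|: F :\ v :\ s v) :\ w -> u \in (A :|: F) :\ w.
    rewrite !inE => /andP[-> /orP[/orP[/eqP->|->]|/and3P[_ _ ->]]] //;
    by rewrite ?svF' orbT.
  move=> x y z xW yW zW e1 e2 e3; rewrite EFD.
  have [hh|hh] := H' x y z (sW _ xW) (sW _ yW) (sW _ zW) e1 e2 e3; last by right.
  by left; apply: (hitD2 sF vFD vN).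
Qed.

End Pairings.

(** * Avoider's pairing strategies in the whole game *)

Section Games.

Variables (T : finType) (e : rel T).
Implicit Types (P Q F A B D W : {set T}) (s : T -> T).

Definition matchable W : Prop :=
  exists P s, [/\ P \subset W, pairing P s & all_hit e W P s].

Lemma odd_pairing_free P s F : P \subset F -> pairing P s -> odd #|F| ->
  exists2 r, r \in F & r \notin P.
Proof.
move=> PF sP oF; have /card_gt0P[r] : 0 < #|F :\: P|.
  rewrite cardsD (setIidPr PF) subn_gt0 ltn_neqAle subset_leq_card // andbT.
  by apply: contraTneq oF => <-; apply: even_pairing sP.
by rewrite inE => /andP[]; exists r.
Qed.

(** With an even number of vertices Enforcer opens and the pairing is extended to all vertices. With
    an odd number Avoider opens at an unpaired vertex, and the rest is paired. *)
Lemma matchable_not_EA : matchable setT -> ~~ EA_K3 e.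
Proof.
move=> [P [s [PT sP H]]]; rewrite /EA_K3 /enforcer_win -cardsT.
have [oT|eT] := boolP (odd #|[set: T]|).
  have [r _ rP] := odd_pairing_free PT sP oT.
  have Er : #|[set: T]| = #|[set: T] :\ r|.+1 by rewrite (cardsD1 r) inE.
  have [s' s'P ss] : exists2 s', pairing ([set: T] :\ r) s' & {in P, s' =1 s}.
    apply: extend_pairing => //; last by rewrite Er /= in oT.
    by apply/subsetP=> x xP; rewrite !inE andbT; apply: contraNneq rP => <-.
  rewrite Er ewin_auxSA -?Er //; apply/negP => /forall_inP /(_ r (in_setT r)).
  rewrite Er /= in oT; rewrite -(even_halfK oT); apply/negP.
  apply: (@Avoider_pairing_last _ _ _ _ _ s'); rewrite ?even_halfK //.
    by rewrite -setI_eq0; apply/eqP/setP=> x; rewrite !inE; case: eqP.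
  move=> x y z xW yW zW e1 e2 e3; apply: (@hit_sub _ P _ s) => //.
    by apply/subsetP=> u uP; rewrite !inE andbT; apply: contraNneq rP => <-.
  exact: H.
have [s' s'P ss] := extend_pairing PT sP eT.
rewrite -(even_halfK eT); apply: (@Avoider_pairing_last _ _ _ _ _ s') => //.
- by rewrite even_halfK.
- by rewrite -setI_eq0 set0I.
- by move=> x y z xW yW zW e1 e2 e3; apply: (hit_sub PT ss); apply: H.
Qed.

(** On the odd set [D] Avoider waits for Enforcer's first move; parity allows extending [P] to the
    rest and each [Q] to [D :\ v]. If Avoider has to open the game, he does so at an unpaired vertex
    outside [D]. *)
Lemma core_not_EE P s D : pairing P s -> odd #|D| -> [disjoint P & D] ->
  (forall v, v \in D -> exists Q s', [/\ Q \subset D :\ v, pairing Q s' &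
     forall x y z, x != v -> y != v -> z != v -> e x y -> e y z -> e x z ->
     hit P s x y z \/ hit Q s' x y z]) ->
  ~~ EE_K3 e.
Proof.
move=> sP oD dPD H; rewrite /EE_K3 /enforcer_win -cardsT.
have PD : P \subset ~: D by rewrite -disjoints_subset.
have H' v : v \in D -> exists2 s', pairing (D :\ v) s' &
   forall x y z, x != v -> y != v -> z != v -> e x y -> e y z -> e x z ->
     hit P s x y z \/ hit (D :\ v) s' x y z.
  move=> vD; have [Q [s' [QD s'P HQ]]] := H v vD.
  have [|s'' s''P ss] := extend_pairing QD s'P.
    by move: oD; rewrite (cardsD1 v) vD.
  exists s'' => // x y z xv yv zv e1 e2 e3.
  have [|hQ] := HQ x y z xv yv zv e1 e2 e3; first by left.
  by right; apply: hit_sub hQ.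
have cT : #|[set: T]| = #|D| + #|~: D| by rewrite cardsC cardsT.
have [oT|eT] := boolP (odd #|[set: T]|).
  have [|s' s'P ss] := extend_pairing PD sP.
    by move: oT; rewrite cT oddD oD.
  have EK : #|[set: T]|./2.*2.+1 = #|[set: T]|.
    by rewrite -[RHS]odd_double_half oT.
  rewrite -EK; apply: (@Avoider_pairing_notlast _ _ _ _ _ D s') => //.
  - by rewrite -setI_eq0 set0I.
  - by rewrite setTD.
  - move=> v vD; have [s'' s''P HQ] := H' v vD; exists s'' => //.
    move=> x y z; rewrite !inE !andbT => xv yv zv e1 e2 e3.
    have [hP|] := HQ x y z xv yv zv e1 e2 e3; last by right.
    by left; rewrite setTD; apply: hit_sub hP.
have oD' : odd #|~: D| by move: eT; rewrite cT oddD oD /= negbK.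
have [r rD rP] := odd_pairing_free PD sP oD'.
have Er : #|[set: T]| = #|[set: T] :\ r|.+1 by rewrite (cardsD1 r) inE.
have PDr : P \subset ~: D :\ r.
  apply/subsetP=> x xP; rewrite inE (subsetP PD) // andbT inE.
  by apply: contraNneq rP => <-.
have [|s' s'P ss] := extend_pairing PDr sP.
  by move: oD'; rewrite (cardsD1 r) rD.
have EK : #|[set: T] :\ r|./2.*2.+1 = #|[set: T] :\ r|.
  by rewrite -[RHS]odd_double_half; move: eT; rewrite Er /= negbK => ->.
rewrite Er ewin_auxSA -?Er; last exact/negbTE.
apply/negP => /forall_inP /(_ r (in_setT r)); apply/negP.
have ED : [set: T] :\ r :\: D = ~: D :\ r.
  by apply/setP=> x; rewrite !inE andbT andbC.
rewrite -EK; apply: (@Avoider_pairing_notlast _ _ _ _ _ D s') => //.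
- by rewrite -setI_eq0; apply/eqP/setP=> x; rewrite !inE; case: eqP.
- apply/subsetP=> x xD; rewrite !inE andbT; apply: contraTneq rD => <-.
  by rewrite inE xD.
- by rewrite ED.
- move=> v vD; have [s'' s''P HQ] := H' v vD; exists s'' => //.
  move=> x y z; rewrite !in_setD1 => /andP[xv _] /andP[yv _] /andP[zv _] e1 e2 e3.
  have [hP|] := HQ x y z xv yv zv e1 e2 e3; last by right.
  by left; rewrite ED; apply: hit_sub hP.
Qed.

(** One end of a pair serves as the odd set: when Enforcer claims it, all triangles containing this
    pair are destroyed. Without pairs there are no triangles, and any single vertex serves. *)
Lemma matchable_not_EE : matchable setT -> ~~ EE_K3 e.
Proof.
move=> [P [s [PT sP H]]].
have [P0|[a aP]] := set_0Vmem P.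
  have N x y z : e x y -> e y z -> e x z -> False.
    by move=> e1 e2 e3; case: (H x y z (in_setT _) (in_setT _) (in_setT _) e1 e2 e3) => t;
      rewrite P0 inE.
  have [T0|[a _]] := set_0Vmem [set: T].
    rewrite /EE_K3 /enforcer_win -cardsT T0 cards0 /=.
    by apply/negP => /has_triangleP[x [y [z [[]]]]]; rewrite inE.
  apply: (@core_not_EE set0 id [set a]) => [|||v _].
  - exact: pairing0.
  - by rewrite cards1.
  - by rewrite -setI_eq0 set0I.
  - exists set0, id; split; rewrite ?sub0set //; first exact: pairing0.
    by move=> x y z _ _ _ e1 e2 e3; case: (N x y z).
have [saP saa ssa] := sP a aP.
have := pairingD2 saP sP; rewrite ssa => sP'.
apply: (core_not_EE (D := [set s a]) sP') => [||v].
- by rewrite cards1.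
- rewrite disjoint_sym disjoints1; by rewrite !inE eqxx andbF.
- rewrite inE => /eqP ->; exists set0, id; split; rewrite ?sub0set //; first exact: pairing0.
  move=> x y z xv yv zv e1 e2 e3; left.
  have := @hitD2 _ [set~ s a] P s (s a) x y z sP saP; rewrite ssa !inE eqxx.
  by apply=> //; apply: H; rewrite ?inE.
Qed.

Lemma ewin_of_triangle l A F : has_triangle e A -> ewin_aux e l #|F| A F.
Proof.
move=> tA; move E: #|F| => k; elim: k A F tA E => [|k IH] A F tA E //.
rewrite [ewin_aux _ _ _ _ _]/=.
have IHv v : v \in F -> #|F :\ v| = k by move=> vF; move: E; rewrite (cardsD1 v) vF => -[].
case: ifP => _.
  apply/forall_inP => v vF; apply: IH (IHv v vF).
  by apply: sub_has_triangle tA; apply: subsetUr.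
have /card_gt0P[v vF] : 0 < #|F| by rewrite E.
by apply/existsP; exists v; rewrite vF /=; apply: IH (IHv v vF).
Qed.

(** * Enforcer's play on disjoint boards *)

Section Boards.

Variables (I : finType) (D : I -> {set T}) (i0 : I).
Hypothesis disjD : forall i j, i != j -> [disjoint D i & D j].
Let U : {set T} := \bigcup_i D i.

(* Enforcer answers on the board on which Avoider just moved; each board has an
   odd number of free vertices before Avoider's move, so Avoider completes one. *)
Lemma Enforcer_boards l A F (L : I -> {set T}) :
  odd #|F| = l -> ~~ odd #|F :\: U| ->
  (forall i, [/\ L i \subset A, odd #|F :&: D i| &
     ewin_aux e true #|F :&: D i| (L i) (F :&: D i)]) ->
  ewin_aux e l #|F| A F.
Proof.
move: {2}#|F| (leqnn #|F|) => m; elim/ltn_ind: m A F L => m IH A F L Fm oF eU H.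
(* The board [i0] has an odd number of free vertices, so the game cannot end before a board is
   completed. *)
have F0 : 0 < #|F|.
  have [_ o0 _] := H i0; apply: leq_trans (subset_leq_card (subsetIl F (D i0))).
  by case: #|_| o0.
move EF: #|F| F0 => [//|k] _; rewrite ewin_auxSA -?EF //.
apply/forall_inP => v vF.
have ck : #|F :\ v| = k by move: EF; rewrite (cardsD1 v) vF => -[].
(* A move outside the boards is answered outside the boards, where an odd number of vertices
   remains. *)
have [vU|vU] := boolP (v \in U); last first.
  have vFU : v \in F :\: U by rewrite inE vU.
  have o1 : odd #|F :\: U :\ v| by move: eU; rewrite (cardsD1 v) vFU /= negbK.
  have /card_gt0P[w] : 0 < #|F :\: U :\ v| by case: #|_| o1.
  rewrite !inE => /and3P[wv wU wF].
  have E2 := cardsD2 vF wF wv.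
  have -> : k = #|F :\ v :\ w|.+1 by rewrite EF in E2; case: E2.
  rewrite ewin_auxSE; last by rewrite -oF E2 /= negbK.
  apply/existsP; exists w; rewrite !inE wv wF; apply: (IH _ _ _ _ L (leqnn _)).
  - by rewrite E2 in Fm; lia.
  - by rewrite -oF E2 /= negbK.
  - have -> : F :\ v :\ w :\: U = F :\: U :\ v :\ w.
      by apply/setP=> x; rewrite !inE; case: (x \in U); rewrite ?andbF.
    by move: o1; rewrite (cardsD1 w) !inE wv wU wF.
  - move=> i; have [LA oi wi] := H i.
    have -> : (F :\ v :\ w) :&: D i = F :&: D i.
      apply/setP=> x; rewrite !inE; case xD: (x \in D i); rewrite ?andbF // !andbT.
      have xU : x \in U by apply/bigcupP; exists i.
      by rewrite (contraTneq _ xU) ?(contraTneq _ xU) // => ->.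
    by split=> //; apply: subset_trans LA (subsetUr _ _).
have /bigcupP[i _ vD] := vU.
have [LA oi wi] := H i.
have vFD : v \in F :&: D i by rewrite inE vF.
have E1 : #|F :&: D i| = #|F :&: D i :\ v|.+1 by rewrite (cardsD1 v) vFD.
move: wi; rewrite {1}E1 ewin_auxSA -?E1 // => /forall_inP /(_ v vFD).
(* If this exhausts the board, Avoider's vertices on it contain a triangle and the remaining play is
   irrelevant. *)
case Ed: #|F :&: D i :\ v| => [|d] wi.
  rewrite -ck; apply: ewin_of_triangle; apply: sub_has_triangle wi.
  exact: setUS.
move: wi; rewrite ewin_auxSE; last first.
  by move: oi; rewrite E1 Ed /= negbK.
move=> /existsP[w /andP[]]; rewrite !inE => /and3P[wv wF wD] wi.
have E2 := cardsD2 vF wF wv.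
have -> : k = #|F :\ v :\ w|.+1 by rewrite EF in E2; case: E2.
rewrite ewin_auxSE; last by rewrite -oF E2 /= negbK.
apply/existsP; exists w; rewrite !inE wv wF.
apply: (IH _ _ _ _ (fun j => if j == i then v |: L i else L j) (leqnn _)).
- by rewrite E2 in Fm; lia.
- by rewrite -oF E2 /= negbK.
- have wU : w \in U by apply/bigcupP; exists i.
  have -> // : F :\ v :\ w :\: U = F :\: U.
  apply/setP=> x; rewrite !inE; case xU: (x \in U) => //=.
  by rewrite (contraFneq _ xU) ?(contraFneq _ xU) // => ->.
move=> j; case: (eqVneq j i) => [->|ji]; last first.
  have [LAj oj wj] := H j.
  have -> : (F :\ v :\ w) :&: D j = F :&: D j.
    apply/setP=> x; rewrite !inE; case xD: (x \in D j); rewrite ?andbF // !andbT.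
    have xN := disjointFr (disjD ji) xD.
    by rewrite (contraFneq _ xN) ?(contraFneq _ xN) // => ->.
  by split=> //; apply: subset_trans LAj (subsetUr _ _).
have E3 : (F :\ v :\ w) :&: D i = F :&: D i :\ v :\ w.
  by apply/setP=> x; rewrite !inE -!andbA.
have wFD : w \in F :&: D i by rewrite inE wF.
have E4 := cardsD2 vFD wFD wv; rewrite E3; split.
- exact: setUS.
- by move: oi; rewrite E4 /= negbK.
- by move: wi; have -> : d = #|F :&: D i :\ v :\ w| by move: E1; rewrite Ed E4 => -[].
Qed.

(** The parity hypothesis says that Avoider opens the game exactly if the number of vertices outside
    the boards is even. Otherwise Enforcer opens it and spends this move outside the boards. *)
Lemma Enforcer_boards_start l :
  (forall i, odd #|D i| /\ ewin_aux e true #|D i| set0 (D i)) ->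
  odd #|T| = l (+) odd #|~: U| -> enforcer_win l e.
Proof.
move=> H par; rewrite /enforcer_win -cardsT.
have [oU|eU] := boolP (odd #|~: U|); last first.
  apply: (@Enforcer_boards _ _ _ (fun=> set0)); rewrite ?setTD //.
    by rewrite cardsT par (negbTE eU) addbF.
  by move=> i; rewrite setTI; have [? ?] := H i; split; rewrite ?sub0set.
have /card_gt0P[r rU] : 0 < #|~: U| by case: #|_| oU.
have Er : #|[set: T]| = #|[set: T] :\ r|.+1 by rewrite (cardsD1 r) inE.
have ol : odd #|[set: T] :\ r| = l.
  by move: par; rewrite oU -cardsT Er /= addbT; case: l; case: (odd _).
rewrite Er ewin_auxSE //; apply/existsP; exists r; rewrite inE.
apply: (@Enforcer_boards _ _ _ (fun=> set0)) => //.
  have -> : [set: T] :\ r :\: U = ~: U :\ r by apply/setP=> x; rewrite !inE andbT andbC.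
  by move: oU; rewrite (cardsD1 r) rU.
move=> i; have -> : ([set: T] :\ r) :&: D i = D i.
  apply/setP=> x; rewrite !inE andbT; case xD: (x \in D i); rewrite ?andbF // andbT.
  by apply: contraTneq rU => <-; rewrite inE negbK; apply/bigcupP; exists i.
by have [? ?] := H i; split; rewrite ?sub0set.
Qed.

End Boards.
End Games.

(** * The game on a single double diamond *)

(** Edges only have to be preserved, not reflected, because additional edges help Enforcer. *)
Lemma ewin_embed (V T : finType) (eV : rel V) (eT : rel T) (phi : V -> T) l k
    (A F : {set V}) :
  injective phi -> (forall x y, eV x y -> eT (phi x) (phi y)) ->
  ewin_aux eV l k A F -> ewin_aux eT l k (phi @: A) (phi @: F).
Proof.
move=> inj hom.
have D1 (G : {set V}) x : phi @: G :\ phi x = phi @: (G :\ x).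
  apply/setP=> y; rewrite !inE; apply/andP/imsetP => [[yx /imsetP[z zG E]]|[z]].
    by exists z => //; rewrite !inE zG andbT; apply: contraNneq yx => <-; rewrite E.
  by rewrite !inE => /andP[zx zG] ->; rewrite (inj_eq inj) zx imset_f.
elim: k A F => [|k IH] A F /=.
  move=> /has_triangleP[x [y [z [[xA yA zA] [e1 e2 e3]]]]]; apply/has_triangleP.
  by exists (phi x), (phi y), (phi z); split; split; rewrite ?imset_f //; apply: hom.
case: ifP => _.
  move=> /forall_inP H; apply/forall_inP => _ /imsetP[x xF ->].
  by rewrite D1 -imsetU1; apply/IH/H.
move=> /existsP[x /andP[xF H]]; apply/existsP; exists (phi x).
by rewrite imset_f //= D1; apply: IH.
Qed.

Definition DDn (u v : nat) : bool :=
  ((u, v) \in DD_edges) || ((v, u) \in DD_edges).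

(** A copy of [ewin_aux DD] on lists of naturals, on which [vm_compute] can search the whole game
    tree. *)
Fixpoint ewin_seq (l : bool) (k : nat) (A F : seq nat) : bool :=
  match k with
  | 0 => has (fun x => has (fun y => DDn x y &&
           has (fun z => DDn y z && DDn x z) A) A) A
  | k'.+1 =>
      if odd k == l then all (fun v => ewin_seq l k' (v :: A) (filter (predC1 v) F)) F
      else has (fun v => ewin_seq l k' A (filter (predC1 v) F)) F
  end.

Definition set_of_nats (s : seq nat) : {set 'I_7} := [set x : 'I_7 | val x \in s].

Lemma ewin_seqP l k A F : all (ltn^~ 7) A -> all (ltn^~ 7) F ->
  ewin_seq l k A F -> ewin_aux DD l k (set_of_nats A) (set_of_nats F).
Proof.
elim: k A F => [|k IH] A F A7 F7 /=.
  move=> /hasP[x xA /hasP[y yA /andP[e1 /hasP[z zA /andP[e2 e3]]]]].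
  have [[x7 y7] z7] := (allP A7 x xA, allP A7 y yA, allP A7 z zA).
  apply/has_triangleP; exists (Ordinal x7), (Ordinal y7), (Ordinal z7).
  by rewrite !inE.
have D1 (v : 'I_7) : set_of_nats F :\ v = set_of_nats (filter (predC1 (val v)) F).
  by apply/setP=> x; rewrite !inE mem_filter /= val_eqE.
have U1 (v : 'I_7) : v |: set_of_nats A = set_of_nats (val v :: A).
  by apply/setP=> x; rewrite !inE -val_eqE.
have F7' v : all (ltn^~ 7) (filter (predC1 v) F).
  by apply/allP=> x; rewrite mem_filter => /andP[_ /(allP F7)].
case: ifP => _.
  move=> /allP H; apply/forall_inP => v; rewrite inE => vF; rewrite D1 U1.
  by apply: IH => //=; [rewrite A7 andbT; exact: (allP F7 _ vF)|apply: H].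
move=> /hasP[v vF H]; apply/existsP; exists (Ordinal (allP F7 v vF)).
by rewrite inE vF D1; apply: IH.
Qed.

Lemma Enforcer_wins_DD : ewin_aux DD true 7 set0 setT.
Proof.
have -> : set0 = set_of_nats [::] by apply/setP=> x; rewrite !inE.
have -> : setT = set_of_nats (iota 0 7) by apply/setP=> x; rewrite in_setT in_set mem_iota ltn_ord.
by apply: ewin_seqP => //; vm_compute.
Qed.

(** * Sparse graphs *)

(* Small graphs are lists E of index pairs into a duplicate-free vertex sequence. *)
Definition adjE (E : seq (nat * nat)) (i j : nat) : bool :=
  ((i, j) \in E) || ((j, i) \in E).

Definition triangles_hit (E M : seq (nat * nat)) (n : nat) : bool :=
  all (fun i => all (fun j => adjE E i j ==> all (fun k =>
    adjE E j k && adjE E i k ==>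
    has (fun p => (p.1 \in [:: i; j; k]) && (p.2 \in [:: i; j; k])) M)
  (iota 0 n)) (iota 0 n)) (iota 0 n).

Section SparseGraphs.

Variables (T : finType) (e : rel T).
Hypotheses (e_sym : symmetric e) (e_irr : irreflexive e).
Implicit Types (S W P : {set T}) (vs : seq T) (E : seq (nat * nat)).

(* Ordered pairs, so this is twice the number of edges spanned by S. *)
Definition e2 S : nat := #|[set p : T * T | [&& p.1 \in S, p.2 \in S & e p.1 p.2]]|.

(* Density at most 10/7, the density of DD.  A triangle has excess 60 - 42 = 18,
   so ten triangles attached at vertices, each costing 2, reach 3 + 20 = 23
   vertices and exhaust it. *)
Definition sparse : bool := [forall S : {set T}, (#|S| <= 23) ==> (7 * e2 S <= 20 * #|S|)].

Definition vset vs : {set T} := [set x in vs].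

Lemma card_vset vs : uniq vs -> #|vset vs| = size vs.
Proof. by move=> u; rewrite /vset cardsE; apply/card_uniqP. Qed.

Lemma e2_add S v s : v \notin S -> uniq s -> all (fun y => (y \in S) && e v y) s ->
  e2 S + 2 * size s <= e2 (v |: S).
Proof.
move=> vS us /allP H.
pose A := [set p : T * T | [&& p.1 \in S, p.2 \in S & e p.1 p.2]].
pose B := [set (v, y) | y in vset s]; pose C := [set (y, v) | y in vset s].
have cB : #|B| = size s by rewrite card_imset ?card_vset // => x y [].
have cC : #|C| = size s by rewrite card_imset ?card_vset // => x y [].
have AB : A :&: B = set0.
  apply/setP=> p; rewrite !inE; apply/andP=> -[/and3P[p1 _ _] /imsetP[y _ E]].
  by move: p1; rewrite E (negbTE vS).
have ABC : (A :|: B) :&: C = set0.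
  apply/setP=> p; rewrite !inE; apply/andP=> -[/orP[/and3P[_ p2 _]|/imsetP[z _ E']] /imsetP[y yS E]].
    by move: p2; rewrite E (negbTE vS).
  have [_ yv] : v = y /\ z = v by move: E; rewrite E' => -[].
  rewrite inE in yS; have /andP[yS' _] := H y yS.
  by move: E yS'; rewrite E' => -[<- _]; rewrite (negbTE vS).
have -> : e2 S + 2 * size s = #|A :|: B :|: C|.
  by rewrite cardsU ABC cards0 cardsU AB cards0 cB cC /e2 -/A; lia.
apply/subset_leq_card/subsetP=> p; rewrite !inE => /orP[/orP[/and3P[-> -> ->]|]|].
- by rewrite !orbT.
- by case/imsetP=> y; rewrite inE => /H /andP[yS evy] -> /=; rewrite eqxx yS evy orbT.
- by case/imsetP=> y; rewrite inE => /H /andP[yS evy] -> /=; rewrite eqxx yS e_sym evy orbT.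
Qed.

(** The orientation [p.1 < p.2] ensures that a duplicate-free [E] lists every edge only once. The
    head of [vs] serves as the default value of [nth]. *)
Definition edges_in vs E : bool := if vs is x0 :: _ then
  all (fun p => [&& p.1 < p.2, p.2 < size vs & e (nth x0 vs p.1) (nth x0 vs p.2)]) E
  else E == [::].

Lemma edges_inP x0 vs E : edges_in vs E -> forall p, p \in E ->
  [/\ p.1 < p.2, p.1 < size vs, p.2 < size vs & e (nth x0 vs p.1) (nth x0 vs p.2)].
Proof.
case: vs => [/eqP -> //|y vs /allP H p /H /and3P[p12 p2]].
rewrite !(set_nth_default x0 y) //; last exact: ltn_trans p2.
by move=> ?; split=> //; apply: ltn_trans p2.
Qed.

Lemma e2_seq vs E : uniq vs -> uniq E -> edges_in vs E -> 2 * size E <= e2 (vset vs).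
Proof.
case: vs => [_ _ /eqP -> //|x0 vs0]; set vs := x0 :: vs0 => uv uE H.
have {}H := edges_inP x0 H.
pose f (p : nat * nat) := (nth x0 vs p.1, nth x0 vs p.2).
pose g (p : nat * nat) := (nth x0 vs p.2, nth x0 vs p.1).
have fI : {in E &, injective f}.
  move=> [a b] [c d] /H [/= _ a1 b1 _] /H [/= _ c1 d1 _] [] /eqP + /eqP.
  by rewrite !nth_uniq // => /eqP -> /eqP ->.
have gI : {in E &, injective g}.
  move=> [a b] [c d] /H [/= _ a1 b1 _] /H [/= _ c1 d1 _] [] /eqP + /eqP.
  by rewrite !nth_uniq // => /eqP -> /eqP ->.
pose L := map f E ++ map g E.
have uL : uniq L.
  rewrite cat_uniq !map_inj_in_uniq // uE andbT /=.
  apply/hasPn=> q /mapP[[a b] /H [/= ab a1 b1 _] ->].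
  apply/mapP=> -[[c d] /H [/= cd c1 d1 _] [] /eqP + /eqP].
  by rewrite !nth_uniq // => /eqP ? /eqP ?; lia.
have -> : 2 * size E = size L by rewrite size_cat !size_map; lia.
rewrite -(card_uniqP uL); apply/subset_leq_card/subsetP=> q; rewrite mem_cat !in_set.
by case/orP=> /mapP[p /H [_ p1 p2 ep] ->]; rewrite /f /g [_.1]/= [_.2]/= !mem_nth // e_sym.
Qed.

Hypothesis e_sparse : sparse.

Lemma sparseP S : #|S| <= 23 -> 7 * e2 S <= 20 * #|S|.
Proof. by move=> cS; move/forallP: e_sparse => /(_ S); rewrite cS. Qed.

Lemma sparse_seq vs E : uniq vs -> size vs <= 23 -> uniq E -> edges_in vs E ->
  7 * size E <= 10 * size vs.
Proof.
move=> uv sv uE H; have := e2_seq uv uE H.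
by have := @sparseP (vset vs); rewrite card_vset // => /(_ sv); lia.
Qed.

(** One further edge would violate sparseness, so the listed edges are all the edges spanned by
    [vs]. *)
Lemma edges_exact x0 vs E : uniq vs -> size vs <= 23 -> uniq E -> edges_in vs E ->
  10 * size vs < 7 * (size E).+1 ->
  forall i j, i < size vs -> j < size vs -> e (nth x0 vs i) (nth x0 vs j) -> adjE E i j.
Proof.
move=> uv sv uE H lt.
have main i j : i < j -> j < size vs -> e (nth x0 vs i) (nth x0 vs j) -> (i, j) \in E.
  move=> ij jv eij; apply/negPn/negP=> nE.
  have := @sparse_seq vs ((i, j) :: E) uv sv; rewrite /= nE uE => /(_ isT).
  suff -> : edges_in vs ((i, j) :: E) by move=> /(_ isT); lia.
  move: H jv eij; rewrite /edges_in; case: (vs) => [|y vs'] // + jv.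
  rewrite !(set_nth_default y x0) //; last by apply: ltn_trans jv.
  by move=> + eij; rewrite /= ij; move: jv eij => /= -> ->.
move=> i j iv jv eij; rewrite /adjE; case: (ltngtP i j) => ij.
- by rewrite main.
- by rewrite (main j i) ?orbT // e_sym.
- by move: eij; rewrite ij e_irr.
Qed.

Lemma pairing_of_seq (L : seq (T * T)) :
  uniq (flatten [seq [:: p.1; p.2] | p <- L]) ->
  exists P s, [/\ P = vset (flatten [seq [:: p.1; p.2] | p <- L]), pairing P s &
    forall p, p \in L -> (p.1 \in P) && (s p.1 == p.2)].
Proof.
elim: L => [_|[a b] L IH /=]; first by exists (vset [::]), id; split=> // x; rewrite !inE.
rewrite inE negb_or => /and3P[/andP[ab aL] bL /IH[P [s [EP sP H]]]].
have dab : [disjoint [set a; b] & P].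
  rewrite -setI_eq0; apply/eqP/setP=> x; rewrite EP !inE.
  by apply/andP=> -[/orP[] /eqP ->]; apply/negP.
pose s0 x := if x == a then b else a.
exists ([set a; b] :|: P), (fun x => if x \in [set a; b] then s0 x else s x); split.
- by apply/setP=> x; rewrite EP !inE orbA.
- apply: pairingU => // x; rewrite !inE /s0.
  by case/orP=> /eqP ->; rewrite ?eqxx ?(eq_sym b) ?(negbTE ab) ?eqxx ?orbT.
- move=> p; rewrite inE => /orP[/eqP ->|/H /andP[pP sp]] /=; rewrite !inE ?eqxx //=.
    by rewrite /s0 !eqxx.
  by rewrite pP orbT /=; have := disjointFl dab pP; rewrite !inE => ->.
Qed.

Lemma matchable_seq x0 vs E (M : seq (nat * nat)) : uniq vs ->
  (forall i j, i < size vs -> j < size vs -> e (nth x0 vs i) (nth x0 vs j) -> adjE E i j) ->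
  uniq (flatten [seq [:: p.1; p.2] | p <- M]) ->
  all (fun p => (p.1 < size vs) && (p.2 < size vs)) M ->
  triangles_hit E M (size vs) -> matchable e (vset vs).
Proof.
move=> uv H uM /allP Mv chk.
pose L := [seq (nth x0 vs p.1, nth x0 vs p.2) | p <- M].
have EL : flatten [seq [:: p.1; p.2] | p <- L] =
          [seq nth x0 vs i | i <- flatten [seq [:: p.1; p.2] | p <- M]].
  by rewrite map_flatten /L -!map_comp.
have Mv' i : i \in flatten [seq [:: p.1; p.2] | p <- M] -> i < size vs.
  by case/flattenP=> _ /mapP[p /Mv /andP[p1 p2] ->]; rewrite !inE => /orP[] /eqP ->.
have [|P [s [EP sP HP]]] := @pairing_of_seq L.
  rewrite EL map_inj_in_uniq // => i j /Mv' iv /Mv' jv /eqP.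
  by rewrite nth_uniq // => /eqP.
exists P, s; split=> //.
  apply/subsetP=> x; rewrite EP EL !inE => /mapP[i /Mv' iv ->]; exact: mem_nth.
move=> x y z; rewrite !inE => xv yv zv.
move: (xv) (yv) (zv); rewrite -!index_mem => ix iy iz.
rewrite -[in e x](nth_index x0 xv) -[in e y](nth_index x0 yv).
rewrite -[in e _ y](nth_index x0 yv) -![in e _ z](nth_index x0 zv).
move=> /H - /(_ ix iy) e1 /H - /(_ iy iz) e2' /H - /(_ ix iz) e3.
have in_iota k : k < size vs -> k \in iota 0 (size vs) by rewrite mem_iota.
move/allP: chk => /(_ _ (in_iota _ ix)) /allP /(_ _ (in_iota _ iy)).
rewrite e1 => /allP /(_ _ (in_iota _ iz)); rewrite e2' e3 => /hasP[p pM /andP[p1 p2]].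
have := HP _ (map_f _ pM) => /andP[/= pP /eqP sp].
exists (nth x0 vs p.1) => //; rewrite sp.
have tr k : k \in [:: index x vs; index y vs; index z vs] -> nth x0 vs k \in [:: x; y; z].
  by rewrite !inE => /or3P[] /eqP ->; rewrite nth_index // eqxx ?orbT.
by rewrite !tr.
Qed.

Definition tclosed W S : Prop := forall x y z, x \in S -> y \in W -> z \in W ->
  e x y -> e y z -> e x z -> (y \in S) && (z \in S).

(** No triangle has vertices on both sides, so the pairings of the two parts combine. *)
Lemma matchable_closed W S : S \subset W -> tclosed W S ->
  matchable e S -> matchable e (W :\: S) -> matchable e W.
Proof.
move=> SW cl [P [s [PS sP HP]]] [Q [s' [QS s'Q HQ]]].
have dPQ : [disjoint P & Q].
  rewrite -setI_eq0; apply/eqP/setP=> x; rewrite !inE; apply/andP=> -[/(subsetP PS) xS].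
  by move=> /(subsetP QS); rewrite inE xS.
exists (P :|: Q), (fun x => if x \in P then s x else s' x); split.
- by rewrite subUset (subset_trans PS SW) (subset_trans QS) // subsetDl.
- exact: pairingU.
move=> x y z xW yW zW e1 e2' e3.
have [xS|xS] := boolP (x \in S).
  have /andP[yS zS] := cl x y z xS yW zW e1 e2' e3.
  by apply: (hit_sub _ _ (HP x y z xS yS zS e1 e2' e3)); rewrite ?subsetUl // => u ->.
have yS : y \notin S.
  by apply: contra xS => yS; have := cl y x z yS xW zW; rewrite e_sym e3 e2' => /(_ e1 isT isT) /andP[].
have zS : z \notin S.
  apply: contra xS => zS; have := cl z x y zS xW yW; rewrite e_sym e3 e1 (e_sym z y) e2'.
  by move=> /(_ isT isT isT) /andP[].
have [||| t tQ ht] := HQ x y z _ _ _ e1 e2' e3; rewrite ?inE ?xS ?yS ?zS //.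
exists t; first by rewrite inE tQ orbT.
by rewrite (disjointFl dPQ tQ).
Qed.

(** Every triangle through [v] or [w] contains both and is hit by the pair itself; all others
    survive the deletion of the pair. *)
Lemma matchable_pair W v w : v \in W -> w \in W -> v != w ->
  (forall x y, x \in W -> y \in W -> e v x -> e v y -> e x y -> (w == x) || (w == y)) ->
  (forall x y, x \in W -> y \in W -> e w x -> e w y -> e x y -> (v == x) || (v == y)) ->
  matchable e (W :\ v :\ w) -> matchable e W.
Proof.
move=> vW wW vw Hv Hw [P [s [PW sP HP]]].
have uvw : uniq (flatten [seq [:: p.1; p.2] | p <- [:: (v, w)]]) by rewrite /= inE vw.
have [Q [s' [EQ s'Q HQ]]] := pairing_of_seq uvw.
have /andP[/= vQ /eqP sv] := HQ (v, w) (mem_head _ _).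
have dQP : [disjoint Q & P].
  rewrite -setI_eq0; apply/eqP/setP=> x; rewrite EQ !inE; apply/andP=> -[+ /(subsetP PW)].
  by rewrite !inE => /orP[] /eqP ->; rewrite eqxx ?andbF.
exists (Q :|: P), (fun x => if x \in Q then s' x else s x); split.
- rewrite subUset (subset_trans PW) ?andbT; last by apply/subsetP=> x; rewrite !inE => /and3P[].
  by apply/subsetP=> x; rewrite EQ !inE => /orP[] /eqP ->.
- exact: pairingU.
have hvw x y z : v \in [:: x; y; z] -> w \in [:: x; y; z] ->
    hit (Q :|: P) (fun x => if x \in Q then s' x else s x) x y z.
  by move=> v3 w3; exists v; [rewrite inE vQ|rewrite vQ sv v3].
move=> x y z xW yW zW e1 e2' e3.
have [E|/negbTE xv] := eqVneq x v.
  subst x; apply: hvw; rewrite !inE ?eqxx //; by rewrite (Hv y z) // orbT.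
have [E|/negbTE xw] := eqVneq x w.
  subst x; apply: hvw; rewrite !inE ?eqxx //; by rewrite (Hw y z) // orbT.
have [E|/negbTE yv] := eqVneq y v.
  subst y; apply: hvw; rewrite !inE ?eqxx ?orbT //.
  by have := Hv x z xW zW; rewrite e_sym e1 e2' e3 => /(_ isT isT isT) /orP[] ->; rewrite ?orbT.
have [E|/negbTE yw] := eqVneq y w.
  subst y; apply: hvw; rewrite !inE ?eqxx ?orbT //.
  by have := Hw x z xW zW; rewrite e_sym e1 e2' e3 => /(_ isT isT isT) /orP[] ->; rewrite ?orbT.
have [E|/negbTE zv] := eqVneq z v.
  subst z; apply: hvw; rewrite !inE ?eqxx ?orbT //.
  by have := Hv x y xW yW; rewrite e_sym e3 e_sym e2' e1 => /(_ isT isT isT) /orP[] ->; rewrite ?orbT.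
have [E|/negbTE zw] := eqVneq z w.
  subst z; apply: hvw; rewrite !inE ?eqxx ?orbT //.
  by have := Hw x y xW yW; rewrite e_sym e3 e_sym e2' e1 => /(_ isT isT isT) /orP[] ->; rewrite ?orbT.
have [||| t tP ht] := HP x y z _ _ _ e1 e2' e3; rewrite ?inE ?xv ?xw ?yv ?yw ?zv ?zw //.
exists t; first by rewrite inE tP orbT.
by rewrite (disjointFl dQP tP).
Qed.

End SparseGraphs.

(** * Growth by triangles in a minimal counterexample *)

Section SparseMatchable.

Variables (T : finType) (e : rel T).
Hypotheses (e_sym : symmetric e) (e_irr : irreflexive e) (e_sparse : sparse e).
Implicit Types (S W P : {set T}) (vs : seq T) (E : seq (nat * nat)).

Local Notation e2 := (e2 e).
Local Notation tclosed := (tclosed e).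
Local Notation matchable := (matchable e).

(** [step1] and [step2] are the two ways in which a triangle can leave [S]: it shares an edge with
    [S], or a single vertex. *)
Definition step1 W S : bool := [exists v in W, exists a in S, exists b in S,
  [&& v \notin S, e v a, e v b & e a b]].
Definition step2 W S : bool := [exists v in W, exists w in W, exists s in S,
  [&& v \notin S, w \notin S, e v w, e s v & e s w]].

Lemma step1P W S : reflect (exists v a b, [/\ v \in W, a \in S & b \in S] /\
  [/\ v \notin S, e v a, e v b & e a b]) (step1 W S).
Proof.
apply: (iffP exists_inP) => [[v vW /exists_inP[a aS /exists_inP[b bS /and4P[? ? ? ?]]]]|].
  by exists v, a, b.
move=> [v [a [b [[vW aS bS] [? ? ? ?]]]]]; exists v => //.
by apply/exists_inP; exists a => //; apply/exists_inP; exists b => //; apply/and4P.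
Qed.

Lemma step2P W S : reflect (exists v w s, [/\ v \in W, w \in W & s \in S] /\
  [/\ v \notin S, w \notin S, e v w, e s v & e s w]) (step2 W S).
Proof.
apply: (iffP exists_inP) => [[v vW /exists_inP[a aS /exists_inP[b bS /and5P[? ? ? ? ?]]]]|].
  by exists v, a, b.
move=> [v [a [b [[vW aS bS] [? ? ? ? ?]]]]]; exists v => //.
by apply/exists_inP; exists a => //; apply/exists_inP; exists b => //; apply/and5P.
Qed.

Lemma tclosed_steps W S : ~~ step1 W S -> ~~ step2 W S -> tclosed W S.
Proof.
move=> n1 n2 x y z xS yW zW e1 e2' e3; apply/andP.
have [yS|yS] := boolP (y \in S); have [zS|zS] := boolP (z \in S); split=> //.
- case/negP: n1; apply/step1P; exists z, x, y; split; split=> //; by rewrite e_sym.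
- case/negP: n1; apply/step1P; exists y, x, z; split; split=> //; by rewrite e_sym.
- by case/negP: n2; apply/step2P; exists y, z, x.
- by case/negP: n2; apply/step2P; exists y, z, x.
Qed.

Lemma neq_of_edge x y : e x y -> x != y.
Proof. by apply: contraTneq => ->; rewrite e_irr. Qed.

Lemma cards_add S v : v \notin S -> #|v |: S| = #|S|.+1.
Proof. by move=> vS; rewrite cardsU1 vS. Qed.

Lemma e2_step1 S v a b : v \notin S -> a \in S -> b \in S -> e v a -> e v b -> e a b ->
  e2 S + 4 <= e2 (v |: S).
Proof.
move=> vS aS bS va vb ab; apply: (@e2_add _ _ e_sym S v [:: a; b]) => //=.
  by rewrite inE neq_of_edge.
by rewrite aS bS va vb.
Qed.

Lemma e2_step2 S v w s : v \notin S -> w \notin S -> s \in S -> e v w -> e s v -> e s w ->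
  e2 S + 6 <= e2 (w |: (v |: S)).
Proof.
move=> vS wS sS vw sv sw.
have h1 : e2 S + 2 <= e2 (v |: S).
  by apply: (@e2_add _ _ e_sym S v [:: s]) => //=; rewrite sS e_sym sv.
suff : e2 (v |: S) + 4 <= e2 (w |: (v |: S)) by move: h1; clear; lia.
apply: (@e2_step1 _ w v s); rewrite ?inE ?eqxx ?sS ?orbT // 1?(e_sym w) // 1?(e_sym v s) //.
by rewrite negb_or wS andbT eq_sym neq_of_edge.
Qed.

(* Without a triangle attached to an edge of S, the two vertices v, w of a
   triangle meeting S in one vertex occur only in triangles containing both,
   unless some triangle leaves S together with v and w. *)
Lemma matchable_pendant W S v w : S \subset W -> ~~ step1 W S ->
  v \in W -> w \in W -> v \notin S -> w \notin S -> e v w ->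
  tclosed W (w |: (v |: S)) -> matchable (W :\ v :\ w) -> matchable W.
Proof.
move=> SW n1 vW wW vS wS vw cl.
have K u u' : u \in W -> u \notin S -> (u == v) && (u' == w) || (u == w) && (u' == v) ->
   forall x y, x \in W -> y \in W -> e u x -> e u y -> e x y -> (u' == x) || (u' == y).
  move=> uW uS uu x y xW yW ux uy xy; apply/negPn/negP; rewrite negb_or => /andP[n3 n4].
  have uC : u \in w |: (v |: S) by case/orP: uu => /andP[/eqP -> _]; rewrite !inE eqxx ?orbT.
  have /andP[xC yC] := cl u x y uC xW yW ux xy uy.
  have inS z : z \in w |: (v |: S) -> e u z -> u' != z -> z \in S.
    move=> zC uz uz'; move: (neq_of_edge uz) zC uz'; rewrite !inE.
    by case/orP: uu => /andP[/eqP -> /eqP ->] /negbTE n5 + /negbTE n6; rewrite !(eq_sym z) n5 n6.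
  case/negP: n1; apply/step1P; exists u, x, y; split; split=> //; exact: inS.
apply: matchable_pair => //; first exact: neq_of_edge.
  by apply: (K v w) => //; rewrite !eqxx.
by apply: (K w v) => //; rewrite !eqxx orbT.
Qed.

Section Minimal.

Variable W : {set T}.
Hypothesis minW : forall W', W' \proper W -> matchable W'.

Lemma minW_D2 v w : v \in W -> matchable (W :\ v :\ w).
Proof.
move=> vW; apply: minW; apply/properP; split.
  by apply/subsetP=> x; rewrite !inE => /and3P[].
by exists v; rewrite // !inE eqxx andbF.
Qed.

Lemma minW_closed S : S \subset W -> S != set0 -> tclosed W S -> matchable S -> matchable W.
Proof.
move=> SW /set0Pn[x xS] cl mS; apply: (matchable_closed e_sym SW cl mS).
apply: minW; apply/properP; split; first exact: subsetDl.
by exists x; [apply: (subsetP SW)|rewrite inE xS].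
Qed.

(* The excess c < 8 excludes the attachment to an edge, so the growth stops with
   a pair to which matchable_pendant applies. *)
Lemma grow_small S c : S \subset W -> 20 * #|S| <= 7 * e2 S + c -> c < 8 -> #|S| + c <= 21 ->
  step1 W S || step2 W S -> matchable W.
Proof.
elim/ltn_ind: c S => c IH S SW fS c8 cS st.
have [/step1P[v [a [b [[vW aS bS] [vS va vb ab]]]]]|n1] := boolP (step1 W S).
  have := e2_step1 vS aS bS va vb ab.
  have := sparseP e_sparse (S := v |: S); rewrite cards_add //.
  by move: fS c8 cS; clear; lia.
rewrite (negbTE n1) in st.
have /step2P[v [w [s [[vW wW sS] [vS wS vw sv sw]]]]] := st.
have f' := e2_step2 vS wS sS vw sv sw.
have w' : w \notin v |: S by rewrite !inE negb_or wS andbT eq_sym neq_of_edge.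
have c' : #|w |: (v |: S)| = #|S|.+2 by rewrite !cards_add.
(* Two new vertices and three new edges lower the excess by 14 * 3 - 20 * 2 = 2, and sparseness
   keeps it nonnegative. *)
have sp : 2 <= c.
  have := sparseP e_sparse (S := w |: (v |: S)); rewrite c'.
  by move: fS c8 cS f'; clear; lia.
have SW' : w |: (v |: S) \subset W by rewrite !subUset !sub1set wW vW.
have [st'|] := boolP (step1 W (w |: (v |: S)) || step2 W (w |: (v |: S))).
  (* The sum of size and excess bound does not change, so all sets met stay within the 23 vertices
     to which sparseness applies. *)
  by apply: (IH (c - 2) _ _ SW') => //; rewrite ?c'; move: fS c8 cS f' sp; clear; lia.
rewrite negb_or => /andP[m1 m2].
by apply: (matchable_pendant SW n1 vW wW vS wS vw (tclosed_steps m1 m2)); apply: minW_D2.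
Qed.

Lemma step_cases S (Q : Prop) : (tclosed W S -> Q) -> (step1 W S -> Q) ->
  (~~ step1 W S -> step2 W S -> Q) -> Q.
Proof.
move=> h0 h1 h2; have [|n1] := boolP (step1 W S); first exact: h1.
by have [|n2] := boolP (step2 W S); [exact: h2|apply/h0/tclosed_steps].
Qed.

(** Every edge of [S] lies in a triangle of [S], so attaching a triangle to an edge would create a
    diamond. Only attachments at a vertex remain, and each costs 2; the growth ends with a removable
    pair, unless an extra edge makes the excess small enough for [grow_small]. *)
Lemma grow_triangles S c : (forall x y z t, x \in W -> y \in W -> z \in W -> t \in W ->
    e x y -> e x z -> e y z -> e x t -> e y t -> z = t) ->
  S \subset W -> 20 * #|S| <= 7 * e2 S + c -> c <= 18 -> #|S| + c <= 21 ->
  (forall a b, a \in S -> b \in S -> e a b -> exists2 d, d \in S & e a d && e b d) ->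
  ~ tclosed W S -> matchable W.
Proof.
move=> nodiam; elim/ltn_ind: c S => c IH S SW fS c18 cS tri ncl.
apply: (@step_cases S) => // [/step1P[v [a [b [[vW aS bS] [vS va vb ab]]]]]|n1 st].
  have [d dS /andP[ad bd]] := tri a b aS bS ab.
  have Edv : d = v.
    by apply: (nodiam a b d v) => //; rewrite 1?e_sym //; apply: (subsetP SW).
  by rewrite -Edv dS in vS.
have /step2P[v [w [s [[vW wW sS] [vS wS vw sv sw]]]]] := st.
have f' := e2_step2 vS wS sS vw sv sw.
have w' : w \notin v |: S by rewrite !inE negb_or wS andbT eq_sym neq_of_edge.
have c' : #|w |: (v |: S)| = #|S|.+2 by rewrite !cards_add.
have sp : 2 <= c.
  have := sparseP e_sparse (S := w |: (v |: S)); rewrite c'.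
  by move: fS cS f' c18 (subset_leq_card SW); clear; lia.
have SW' : w |: (v |: S) \subset W by rewrite !subUset !sub1set wW vW.
have [st'|] := boolP (step1 W (w |: (v |: S)) || step2 W (w |: (v |: S))); last first.
  rewrite negb_or => /andP[m1 m2].
  by apply: (matchable_pendant SW n1 vW wW vS wS vw (tclosed_steps m1 m2)); apply: minW_D2.
(* A fourth new edge lowers the excess by 14 more, hence by 16 in total, to at most 2. *)
have [/existsP[y /and3P[yS ys /orP[vy|wy]]]|nex] :=
  boolP [exists y, [&& y \in S, y != s & e v y || e w y]].
- apply: (@grow_small (w |: (v |: S)) (c - 16)) => //; rewrite ?c'; try (by move: c18 cS sp; clear; lia).
  have h1 : e2 S + 4 <= e2 (v |: S).
    apply: (@e2_add _ _ e_sym S v [:: y; s]) => //=; first by rewrite inE ys.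
    by rewrite sS yS vy e_sym sv.
  have h2 : e2 (v |: S) + 4 <= e2 (w |: (v |: S)).
    apply: (@e2_add _ _ e_sym _ w [:: v; s]) => //=.
      by rewrite inE eq_sym neq_of_edge.
    by rewrite !inE eqxx sS e_sym vw orbT e_sym sw.
  by move: fS h1 h2 c18; clear; lia.
- apply: (@grow_small (w |: (v |: S)) (c - 16)) => //; rewrite ?c'; try (by move: c18 cS sp; clear; lia).
  have h1 : e2 S + 2 <= e2 (v |: S).
    by apply: (@e2_add _ _ e_sym S v [:: s]) => //=; rewrite sS e_sym sv.
  have h2 : e2 (v |: S) + 6 <= e2 (w |: (v |: S)).
    apply: (@e2_add _ _ e_sym _ w [:: v; s; y]) => //=.
      have vs : v != s by rewrite eq_sym neq_of_edge.
      have vy : v != y by apply: contraTneq yS => <-.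
      by rewrite !inE negb_or (eq_sym s y) ys vs vy.
    by rewrite !inE eqxx sS yS e_sym vw !orbT e_sym sw wy.
  by move: fS h1 h2 c18; clear; lia.
(* Otherwise [s] is the only neighbour of [v] and [w] in [S], so the edges of the enlarged set still
   lie in its triangles. *)
have only u y : u \in [:: v; w] -> y \in S -> e u y -> y = s.
  move=> u2 yS uy; apply/eqP; apply: contraNT nex => ys; apply/existsP; exists y.
  by rewrite yS ys; move: u2; rewrite !inE => /orP[] /eqP <-; rewrite uy ?orbT.
apply: (IH (c - 2) _ (w |: (v |: S))); rewrite ?c' //; try (by move: fS cS f' c18 sp; clear; lia).
  have swv : forall a b, a \in [:: s; v; w] -> b \in [:: s; v; w] -> e a b ->
      exists2 d, d \in w |: (v |: S) & e a d && e b d.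
    have [vs ws wv] : [/\ e v s, e w s & e w v] by rewrite e_sym sv e_sym sw e_sym.
    move=> a b; rewrite !inE => /or3P[] /eqP -> /or3P[] /eqP ->; rewrite ?e_irr // => _;
      [exists w|exists v|exists w|exists s|exists v|exists s];
      by rewrite ?inE ?eqxx ?sS ?orbT // ?vw ?sv ?sw ?vs ?ws ?wv.
  move=> a b; rewrite !inE => /or3P[/eqP->|/eqP->|aS] /or3P[/eqP->|/eqP->|bS] ab.
  - by apply: swv; rewrite ?inE ?eqxx ?orbT.
  - by apply: swv; rewrite ?inE ?eqxx ?orbT.
  - have Eb : b = s by apply: (only w) => //; rewrite ?inE ?eqxx ?orbT.
    by subst b; apply: swv; rewrite ?inE ?eqxx ?orbT.
  - by apply: swv; rewrite ?inE ?eqxx ?orbT.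
  - by apply: swv; rewrite ?inE ?eqxx ?orbT.
  - have Eb : b = s by apply: (only v) => //; rewrite ?inE ?eqxx ?orbT.
    by subst b; apply: swv; rewrite ?inE ?eqxx ?orbT.
  - have Ea : a = s by apply: (only w) => //; rewrite ?inE ?eqxx ?orbT // e_sym.
    by subst a; apply: swv; rewrite ?inE ?eqxx ?orbT.
  - have Ea : a = s by apply: (only v) => //; rewrite ?inE ?eqxx ?orbT // e_sym.
    by subst a; apply: swv; rewrite ?inE ?eqxx ?orbT.
  - by have [d dS H] := tri a b aS bS ab; exists d => //; rewrite !inE dS !orbT.
move=> cl; case/orP: st'.
  move=> /step1P[u [a [b [[uW aS bS] [uS ua ub ab]]]]].
  have au : e a u by rewrite e_sym.
  by have /andP[uS' _] := cl a u b aS uW (subsetP SW' _ bS) au ub ab; rewrite uS' in uS.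
move=> /step2P[u [u' [a [[uW u'W aS] [uS u'S uu' au au']]]]].
by have /andP[uS' _] := cl a u u' aS uW u'W au uu' au'; rewrite uS' in uS.
Qed.

End Minimal.
End SparseMatchable.

(** * Finite checks of the small configurations *)

Definition index_matching (E : seq (nat * nat)) (n : nat) (M : seq (nat * nat)) : bool :=
  [&& uniq (flatten [seq [:: p.1; p.2] | p <- M]),
      all (fun p => (p.1 < n) && (p.2 < n)) M & triangles_hit E M n].

Definition index_DD (E : seq (nat * nat)) (n : nat) (pi : seq nat) : bool :=
  [&& size pi == 7, uniq pi, all (ltn^~ n) pi &
      all (fun p => adjE E (nth 0 pi p.1) (nth 0 pi p.2)) DD_edges].

(** Vertices 0 and 1 span the common edge of the two triangles, so the pair [(0, 1)] hits both. *)
Definition diamond_edges : seq (nat * nat) := [:: (0,1); (0,2); (0,3); (1,2); (1,3)].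

(** If the third triangle is not attached to the edge [(0, 1)], it contains vertex 4 and one of 2
    and 3, which form a second pair. *)
Lemma diamond_step1_matching i j : i < 4 -> j < 4 -> adjE diamond_edges i j ->
  uniq [:: (i, 4), (j, 4) & diamond_edges] &&
  has (index_matching [:: (i, 4), (j, 4) & diamond_edges] 5)
    [:: [:: (0, 1)]; [:: (0, 1); (2, 4)]; [:: (0, 1); (3, 4)]].
Proof.
have : all (fun i => all (fun j => adjE diamond_edges i j ==>
  (uniq [:: (i, 4), (j, 4) & diamond_edges] &&
  has (index_matching [:: (i, 4), (j, 4) & diamond_edges] 5)
    [:: [:: (0, 1)]; [:: (0, 1); (2, 4)]; [:: (0, 1); (3, 4)]])) (iota 0 4)) (iota 0 4).
  by vm_compute.
have io k0 n : k0 < n -> k0 \in iota 0 n by rewrite mem_iota.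
by move=> H /io i4 /io j4; apply/implyP; exact: (allP (allP H i i4) j j4).
Qed.

Definition diamond_triangle i : seq (nat * nat) :=
  [:: (i, 4), (i, 5), (4, 5) & diamond_edges].

(* A diamond and a triangle meeting in vertex i, extended by a vertex 6 attached
   to an edge of the triangle. *)
Lemma diamond_step2_matching i j k : i < 4 -> j < 6 -> k < 6 ->
  adjE (diamond_triangle i) j k -> ~~ ((j < 4) && (k < 4)) ->
  uniq [:: (j, 6), (k, 6) & diamond_triangle i] &&
  (has (index_matching [:: (j, 6), (k, 6) & diamond_triangle i] 7)
    [:: [:: (0, 1); (4, 5)]; [:: (0, 1); (i, 4)]; [:: (0, 1); (i, 5)]]
  || has (index_DD [:: (j, 6), (k, 6) & diamond_triangle i] 7)
    [:: [:: 0; 1; 2; 3; 4; 5; 6]; [:: 0; 1; 2; 3; 5; 4; 6];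
        [:: 1; 0; 2; 3; 4; 5; 6]; [:: 1; 0; 2; 3; 5; 4; 6]]).
Proof.
have : all (fun i => all (fun j => all (fun k => adjE (diamond_triangle i) j k ==>
  ~~ ((j < 4) && (k < 4)) ==>
  (uniq [:: (j, 6), (k, 6) & diamond_triangle i] &&
  (has (index_matching [:: (j, 6), (k, 6) & diamond_triangle i] 7)
    [:: [:: (0, 1); (4, 5)]; [:: (0, 1); (i, 4)]; [:: (0, 1); (i, 5)]]
  || has (index_DD [:: (j, 6), (k, 6) & diamond_triangle i] 7)
    [:: [:: 0; 1; 2; 3; 4; 5; 6]; [:: 0; 1; 2; 3; 5; 4; 6];
        [:: 1; 0; 2; 3; 4; 5; 6]; [:: 1; 0; 2; 3; 5; 4; 6]])))
   (iota 0 6)) (iota 0 6)) (iota 0 4).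
  by vm_compute.
have io k0 n : k0 < n -> k0 \in iota 0 n by rewrite mem_iota.
move=> H /io i4 /io j6 /io k6 ad; apply/implyP; move: ad; apply/implyP.
exact: (allP (allP (allP H i i4) j j6) k k6).
Qed.

(** * Sparse sets without double diamonds are matchable *)

Section DoubleDiamonds.

Variables (T : finType) (e : rel T).
Hypotheses (e_sym : symmetric e) (e_irr : irreflexive e).
Implicit Types (S W P : {set T}) (vs : seq T) (E : seq (nat * nat)).

Definition is_DD vs : bool := [&& size vs == 7, uniq vs & edges_in e vs DD_edges].

Lemma vset_rcons vs u : vset (rcons vs u) = u |: vset vs.
Proof. by apply/setP=> x; rewrite !inE mem_rcons inE. Qed.

Lemma edges_inI x0 vs E : (forall p, p \in E ->
    [&& p.1 < p.2, p.2 < size vs & e (nth x0 vs p.1) (nth x0 vs p.2)]) -> edges_in e vs E.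
Proof.
case: vs => [|y vs] H.
  by case: E H => // p E /(_ p (mem_head _ _)) /and3P[].
apply/allP=> p /H /and3P[p12 p2]; rewrite p12 p2.
by rewrite !(set_nth_default y x0) //; apply: ltn_trans p2.
Qed.

Lemma edges_in_rcons vs u E : edges_in e vs E -> edges_in e (rcons vs u) E.
Proof.
move=> H; apply: (@edges_inI u) => p /(edges_inP u H) [p12 p1 p2 ep].
by rewrite !nth_rcons p1 p2 p12 ep size_rcons ltnS ltnW.
Qed.

Lemma edges_in_cons x0 vs E i j : i < j -> j < size vs -> e (nth x0 vs i) (nth x0 vs j) ->
  edges_in e vs E -> edges_in e vs ((i, j) :: E).
Proof.
move=> ij jv eij H; apply: (@edges_inI x0) => p; rewrite inE => /orP[/eqP ->|pE] /=.
  by rewrite ij jv.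
by have [-> _ -> ->] := edges_inP x0 H pE.
Qed.

Lemma is_DD_of_index x0 vs E pi : uniq vs -> edges_in e vs E ->
  index_DD E (size vs) pi -> is_DD [seq nth x0 vs i | i <- pi].
Proof.
move=> uv H /and4P[/eqP s7 upi /allP pin /allP dd]; rewrite /is_DD size_map s7 eqxx /=.
apply/andP; split.
  rewrite map_inj_in_uniq // => i j /pin iv /pin jv /eqP.
  by rewrite nth_uniq // => /eqP.
apply: (@edges_inI x0) => p pD; rewrite size_map s7.
have /andP[p12 p7] : (p.1 < p.2) && (p.2 < 7).
  by move: p pD; apply/allP.
rewrite p12 p7 /= !(nth_map 0) ?s7 //; last exact: ltn_trans p7.
by case/orP: (dd p pD) => /(edges_inP x0 H) [_ _ _]; rewrite //= e_sym.
Qed.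

Hypothesis e_sparse : sparse e.

Lemma matchable_index (x0 : T) vs E Ms : uniq vs -> size vs <= 23 -> uniq E -> edges_in e vs E ->
  10 * size vs < 7 * (size E).+1 -> has (index_matching E (size vs)) Ms ->
  matchable e (vset vs).
Proof.
move=> uv sv uE EE lt /hasP[M _ /and3P[uM aM tM]].
by apply: (matchable_seq (x0 := x0) uv _ uM aM tM); apply: edges_exact.
Qed.

(** The diamond has excess 20 * 4 - 14 * 5 = 10. A triangle at an edge leaves 2, and [grow_small]
    finishes. A triangle at a vertex leaves 8; a further one at an edge then leaves 0 and one at a
    vertex leaves 6, both again within reach of [grow_small]. When the growth stops, either the set
    is matched explicitly or the last pair is removed. *)
Lemma diamond_matchable W x y z t :
  (forall W', W' \proper W -> matchable e W') ->
  (forall vs, is_DD vs -> ~~ (vset vs \subset W)) ->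
  x \in W -> y \in W -> z \in W -> t \in W ->
  e x y -> e x z -> e y z -> e x t -> e y t -> z != t -> matchable e W.
Proof.
move=> minW noDD xW yW zW tW xy xz yz xt yt zt.
pose vs0 := [:: x; y; z; t].
have uv0 : uniq vs0.
  by rewrite /= !inE !negb_or zt !(neq_of_edge e_irr).
have E0 : edges_in e vs0 diamond_edges by rewrite /= xy xz xt yz yt.
have sub_vset vs : {subset vs <= W} -> vset vs \subset W.
  by move=> H; apply/subsetP=> u; rewrite inE => /H.
have vs0W : {subset vs0 <= W} by move=> u; rewrite !inE => /or4P[] /eqP ->.
have S0W := sub_vset _ vs0W.
have f0 := e2_seq e_sym uv0 (isT : uniq diamond_edges) E0.
(* The diamond is induced, because 7 * 6 > 10 * 4. *)
have ex0 := @edges_exact _ _ e_sym e_irr e_sparse x vs0 _ uv0 isT (isT : uniq diamond_edges) E0 isT.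
have nz u vs : u \in vs -> vset vs != set0 by move=> uv; apply/set0Pn; exists u; rewrite inE.
apply: (@step_cases _ e e_sym W (vset vs0)) => [cl|/step1P|n1 /step2P].
- apply: (minW_closed e_sym minW S0W (nz x _ (mem_head _ _)) cl).
  by apply: (matchable_index (Ms := [:: [:: (0, 1)]]) x uv0 _ _ E0).
- move=> [u [a [b [[uW aS bS] [uS ua ub ab]]]]].
  move: (aS) (bS) (uS); rewrite !in_set => a0 b0 u0.
  have ia : index a vs0 < 4 by rewrite index_mem.
  have ib : index b vs0 < 4 by rewrite index_mem.
  have ad : adjE diamond_edges (index a vs0) (index b vs0).
    by apply: ex0; rewrite ?nth_index.
  have /andP[uE1 M1] := diamond_step1_matching ia ib ad.
  pose vs1 := rcons vs0 u.
  have uv1 : uniq vs1 by rewrite rcons_uniq u0.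
  have E1 : edges_in e vs1 [:: (index a vs0, 4), (index b vs0, 4) & diamond_edges].
    have n1 c : c \in vs0 -> index c vs0 < 4 -> nth x vs1 (index c vs0) = c.
      by move=> c0 c4; rewrite nth_rcons c4 nth_index.
    apply: (@edges_in_cons x) => //; first by rewrite n1 // e_sym.
    apply: (@edges_in_cons x) => //; first by rewrite n1 // e_sym.
  have S1W : vset vs1 \subset W by rewrite vset_rcons subUset sub1set uW.
  have f1 := e2_seq e_sym uv1 uE1 E1.
  have small : step1 e W (vset vs1) || step2 e W (vset vs1) -> matchable e W.
    apply: (grow_small e_sym e_irr e_sparse minW (c := 2) S1W) => //.
      by rewrite card_vset //; move: f1; clear; rewrite /=; lia.
    by rewrite card_vset.
  apply: (@step_cases _ e e_sym W (vset vs1)) => [cl|s1|_ s2].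
  + apply: (minW_closed e_sym minW S1W (nz x vs1 (mem_head _ _)) cl).
    exact: (matchable_index x uv1 _ uE1 E1 _ M1).
  + by apply: small; rewrite s1.
  + by apply: small; rewrite s2 orbT.
move=> [v [w [s [[vW wW sS] [vS wS vw sv sw]]]]].
move: (sS) (vS) (wS); rewrite !in_set => s0 v0 w0.
have is0 : index s vs0 < 4 by rewrite index_mem.
pose i := index s vs0; pose vs2 := rcons (rcons vs0 v) w.
have w' : w \notin rcons vs0 v.
  by rewrite mem_rcons inE negb_or w0 andbT eq_sym (neq_of_edge e_irr).
have uv2 : uniq vs2 by rewrite rcons_uniq w' rcons_uniq v0.
have n2i : nth x vs2 i = s by rewrite !nth_rcons size_rcons /i is0 (leqW is0) nth_index.
have E2 : edges_in e vs2 (diamond_triangle i).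
  apply: (@edges_in_cons x) => //; first by rewrite n2i.
  apply: (@edges_in_cons x) => //; [exact: leqW|by rewrite n2i|].
  by apply: (@edges_in_cons x) => //.
have uE2 : uniq (diamond_triangle i).
  by move: is0; rewrite -/i; case: (i) => [|[|[|[|]]]].
have sz2 : size (diamond_triangle i) = 8 by [].
have S2E : vset vs2 = w |: (v |: vset vs0) by rewrite !vset_rcons.
have S2W : vset vs2 \subset W by rewrite S2E !subUset !sub1set wW vW.
have f2 := e2_seq e_sym uv2 uE2 E2.
apply: (@step_cases _ e e_sym W (vset vs2)) => [cl|/step1P|m1 /step2P].
- rewrite S2E in cl; apply: (matchable_pendant e_sym e_irr S0W n1 vW wW vS wS vw cl).
  exact: minW_D2.
- move=> [u [a [b [[uW aS bS] [uS ua ub ab]]]]].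
  move: (aS) (bS) (uS); rewrite !in_set => a2 b2 u2.
  have ja : index a vs2 < 6 by rewrite index_mem.
  have kb : index b vs2 < 6 by rewrite index_mem.
  have ad : adjE (diamond_triangle i) (index a vs2) (index b vs2).
    apply: (@edges_exact _ _ e_sym e_irr e_sparse x vs2) => //.
    by rewrite !nth_index.
  (* An edge inside the diamond would already have allowed [step1] before [v] and [w] were added. *)
  have njk : ~~ ((index a vs2 < 4) && (index b vs2 < 4)).
    apply/negP=> /andP[ja4 kb4]; case/negP: n1; apply/step1P; exists u, a, b.
    have in0 c : c \in vs2 -> index c vs2 < 4 -> c \in vset vs0.
      move=> c2 c4; rewrite inE -(nth_index x c2) !nth_rcons size_rcons /=.
      by rewrite (leqW c4) c4 mem_nth.
    split; split=> //; try exact: in0.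
    by move: uS; rewrite S2E !inE !negb_or => /and3P[].
  have /andP[uE3 alt] := diamond_step2_matching is0 ja kb ad njk.
  pose vs3 := rcons vs2 u.
  have uv3 : uniq vs3 by rewrite rcons_uniq u2.
  have E3 : edges_in e vs3 [:: (index a vs2, 6), (index b vs2, 6) & diamond_triangle i].
    have n3 c : c \in vs2 -> index c vs2 < 6 -> nth x vs3 (index c vs2) = c.
      by move=> c0 c6; rewrite nth_rcons c6 nth_index.
    apply: (@edges_in_cons x) => //; first by rewrite n3 // e_sym.
    apply: (@edges_in_cons x) => //; first by rewrite n3 // e_sym.
    exact: (edges_in_rcons u E2).
  have S3W : vset vs3 \subset W by rewrite vset_rcons subUset sub1set uW.
  case/orP: alt => [M3|/hasP[pi _ dd]]; last first.
    have := noDD _ (is_DD_of_index x uv3 E3 dd); case/negP.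
    apply: sub_vset => c /mapP[k kpi ->]; apply: (subsetP S3W); rewrite inE mem_nth //.
    by have /and4P[_ _ /allP H _] := dd; apply: H.
  have f3 := e2_seq e_sym uv3 uE3 E3.
  have small : step1 e W (vset vs3) || step2 e W (vset vs3) -> matchable e W.
    apply: (grow_small e_sym e_irr e_sparse minW (c := 0) S3W) => //.
      by rewrite card_vset //; move: f3; clear; rewrite /=; lia.
    by rewrite card_vset.
  apply: (@step_cases _ e e_sym W (vset vs3)) => [cl|s1|_ s2].
  + apply: (minW_closed e_sym minW S3W (nz x vs3 (mem_head _ _)) cl).
    exact: (matchable_index x uv3 _ uE3 E3 _ M3).
  + by apply: small; rewrite s1.
  + by apply: small; rewrite s2 orbT.
move=> [v' [w1 [s1 [[v'W w1W s1S] [v'S w1S vw1 sv1 sw1]]]]].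
have f4 := e2_step2 e_sym e_irr v'S w1S s1S vw1 sv1 sw1.
have c4 : #|w1 |: (v' |: vset vs2)| = 8.
  rewrite !cards_add ?card_vset // in_setU1 negb_or w1S andbT.
  by rewrite eq_sym (neq_of_edge e_irr).
have S4W : w1 |: (v' |: vset vs2) \subset W by rewrite !subUset !sub1set w1W v'W.
have small : step1 e W (w1 |: (v' |: vset vs2)) || step2 e W (w1 |: (v' |: vset vs2)) ->
    matchable e W.
  apply: (grow_small e_sym e_irr e_sparse minW (c := 6) S4W); rewrite ?c4 //.
  by move: f2 f4; clear; rewrite /=; lia.
apply: (@step_cases _ e e_sym W (w1 |: (v' |: vset vs2))) => [cl|st1|_ st2].
- apply: (matchable_pendant e_sym e_irr S2W m1 v'W w1W v'S w1S vw1 cl).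
  exact: minW_D2.
- by apply: small; rewrite st1.
- by apply: small; rewrite st2 orbT.
Qed.

(** Strong induction on the size makes all proper subsets matchable. The growth starts from a
    diamond if there is one, else from a triangle; without triangles the empty pairing works. *)
Lemma sparse_matchable W : (forall vs, is_DD vs -> ~~ (vset vs \subset W)) -> matchable e W.
Proof.
move: {2}#|W| (leqnn #|W|) => m; elim/ltn_ind: m W => m IH W Wm noDD.
have minW W' : W' \proper W -> matchable e W'.
  move=> pW; apply: (IH #|W'| _ _ (leqnn _)).
    exact: leq_trans (proper_card pW) Wm.
  move=> vs dd; apply: contra (noDD vs dd) => sW; apply: subset_trans sW _.
  exact: proper_sub.
have [/exists_inP[x xW /exists_inP[y yW /exists_inP[z zW /exists_inP[t tW]]]]|nd] :=
  boolP [exists x in W, exists y in W, exists z in W, exists t in W,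
    [&& e x y, e x z, e y z, e x t & e y t && (z != t)]].
  by move=> /and5P[xy xz yz xt /andP[yt zt]]; apply: (@diamond_matchable W x y z t).
have nodiam x y z t : x \in W -> y \in W -> z \in W -> t \in W ->
    e x y -> e x z -> e y z -> e x t -> e y t -> z = t.
  move=> xW yW zW tW xy xz yz xt yt; apply/eqP; apply: contraNT nd => zt.
  apply/exists_inP; exists x => //; apply/exists_inP; exists y => //.
  apply/exists_inP; exists z => //; apply/exists_inP; exists t => //.
  by rewrite xy xz yz xt yt.
have [/has_triangleP[x [y [z [[xW yW zW] [xy yz xz]]]]]|nt] := boolP (has_triangle e W); last first.
  exists set0, id; split; rewrite ?sub0set //; first exact: pairing0.
  move=> x y z xW yW zW e1 e2' e3; case/negP: nt; apply/has_triangleP.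
  by exists x, y, z.
pose vs := [:: x; y; z]; pose K3 := [:: (0, 1); (0, 2); (1, 2)].
have uv : uniq vs by rewrite /= !inE negb_or !(neq_of_edge e_irr).
have EK : edges_in e vs K3 by rewrite /= xy yz xz.
have SW : vset vs \subset W.
  by apply/subsetP=> u; rewrite !inE => /or3P[] /eqP ->.
have f := e2_seq e_sym uv (isT : uniq K3) EK.
have grow : ~ tclosed e W (vset vs) -> matchable e W.
  apply: (grow_triangles e_sym e_irr e_sparse minW (c := 18) nodiam SW) => //.
  - by rewrite card_vset //; move: f; clear; rewrite /=; lia.
  - by rewrite card_vset.
  move=> a b; rewrite !inE => /or3P[] /eqP -> /or3P[] /eqP ->; rewrite ?e_irr // => _;
    [exists z|exists y|exists z|exists x|exists y|exists x];
    by rewrite ?inE ?eqxx ?orbT // ?xy ?xz ?yz // ?(e_sym y x) ?(e_sym z x) ?(e_sym z y) ?xy ?xz ?yz.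
apply: (@step_cases _ e e_sym W (vset vs)) => [cl|/step1P|n1 /step2P].
- apply: (minW_closed e_sym minW SW _ cl); first by apply/set0Pn; exists x; rewrite !inE eqxx.
  apply: (@matchable_seq _ _ x vs K3 [:: (0, 1)]) => //.
  by move=> [|[|[|i]]] [|[|[|j]]] //= _ _; rewrite e_irr.
- move=> [u [a [b [[uW aS bS] [uS ua ub ab]]]]]; apply: grow => cl.
  have au : e a u by rewrite e_sym.
  by have /andP[uS' _] := cl a u b aS uW (subsetP SW _ bS) au ub ab; rewrite uS' in uS.
- move=> [u [u' [a [[uW u'W aS] [uS u'S uu' au au']]]]]; apply: grow => cl.
  by have /andP[uS' _] := cl a u u' aS uW u'W au uu' au'; rewrite uS' in uS.
Qed.

End DoubleDiamonds.

(** * Outcome of the game on sparse graphs *)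

Section SparseGame.

Variables (T : finType) (e : rel T).
Hypotheses (e_sym : symmetric e) (e_irr : irreflexive e).
Implicit Types (S W P : {set T}) (vs : seq T) (phi : {ffun 'I_7 -> T}).

Lemma embeddingP phi : reflect
  (injective phi /\ forall i j, DD i j -> e (phi i) (phi j)) (embeddingb DD e phi).
Proof.
apply: (iffP andP) => [[/injectiveP inj /forallP H]|[inj H]]; split=> //.
- by move=> i j; move/forallP: (H i) => /(_ j) /implyP.
- exact/injectiveP.
- by apply/forallP=> i; apply/forallP=> j; apply/implyP; apply: H.
Qed.

Lemma nth_codom_ord x0 phi (i : 'I_7) : nth x0 (codom phi) i = phi i.
Proof.
by rewrite /codom /image_mem (nth_map i) ?size_enum_ord // nth_ord_enum.
Qed.

Lemma embedding_is_DD phi : embeddingb DD e phi -> is_DD e (codom phi).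
Proof.
case/embeddingP=> inj H; rewrite /is_DD size_codom card_ord eqxx /=.
apply/andP; split; first by rewrite map_inj_uniq ?enum_uniq.
apply: (@edges_inI _ _ (phi ord0)) => p pD; rewrite size_codom card_ord.
have /andP[p12 p7] : (p.1 < p.2) && (p.2 < 7) by move: p pD; apply/allP.
have p17 := ltn_trans p12 p7; rewrite p12 p7 /=.
rewrite (nth_codom_ord _ _ (Ordinal p17)) (nth_codom_ord _ _ (Ordinal p7)); apply: H.
by rewrite /DD /= -surjective_pairing pD.
Qed.

Lemma vset_codom phi : vset (codom phi) = phi @: setT.
Proof.
apply/setP=> x; rewrite inE; apply/codomP/imsetP => [[i ->]|[i _ ->]]; first by exists i.
by exists i.
Qed.

Lemma is_DD_embedding vs : is_DD e vs ->
  exists2 phi, embeddingb DD e phi & phi @: setT = vset vs.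
Proof.
case/and3P=> /eqP s7 uv Ev.
case: vs s7 uv Ev => [//|x0 vs0]; set vs := x0 :: vs0 => s7 uv Ev.
exists [ffun i : 'I_7 => nth x0 vs i].
  apply/embeddingP; split=> [i j|i j].
    by rewrite !ffunE => /eqP; rewrite nth_uniq ?s7 // => /eqP/val_inj.
  by rewrite !ffunE => /orP[] /(edges_inP x0 Ev) [_ _ _] //=; rewrite e_sym.
apply/setP=> x; rewrite inE; apply/imsetP/idP => [[i _ ->]|xv].
  by rewrite ffunE mem_nth // s7.
have ix : index x vs < 7 by rewrite -s7 index_mem.
by exists (Ordinal ix); rewrite ?inE // ffunE nth_index.
Qed.

Lemma card_DD vs : is_DD e vs -> #|vset vs| = 7.
Proof. by case/and3P=> /eqP s7 uv _; rewrite card_vset. Qed.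

(** Every vertex of a double diamond shares a triangle with the centre [a], so closure under
    triangles reaches [a] and from there all vertices. *)
Lemma tclosed_DD S vs x : tclosed e setT S -> is_DD e vs -> x \in vs -> x \in S ->
  vset vs \subset S.
Proof.
move=> cl /and3P[/eqP s7 _ Ev] xv xS.
case: vs s7 Ev xv => [|a [|b [|c [|d [|f [|g [|h [|]]]]]]]] // _ /=.
move=> /and5P[ab ac ad bc /and5P[bd af ag ah /and3P[fg fh _]]] xv.
have cl' u v w : e u v -> e v w -> e u w -> u \in S -> (v \in S) && (w \in S).
  by move=> uv vw uw uS; apply: (cl u); rewrite ?inE.
have aS : a \in S.
  move: xv; rewrite !inE => /orP[/eqP <- //|].
  case/orP=> [/eqP E|]; first by subst x; case/andP: (cl' b a c ltac:(by rewrite e_sym) ac bc xS).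
  case/orP=> [/eqP E|]; first by subst x; case/andP: (cl' c a b ltac:(by rewrite e_sym) ab ltac:(by rewrite e_sym) xS).
  case/orP=> [/eqP E|]; first by subst x; case/andP: (cl' d a b ltac:(by rewrite e_sym) ab ltac:(by rewrite e_sym) xS).
  case/orP=> [/eqP E|]; first by subst x; case/andP: (cl' f a g ltac:(by rewrite e_sym) ag fg xS).
  case/orP=> /eqP E; first by subst x; case/andP: (cl' g a f ltac:(by rewrite e_sym) af ltac:(by rewrite e_sym) xS).
  by subst x; case/andP: (cl' h a f ltac:(by rewrite e_sym) af ltac:(by rewrite e_sym) xS).
have /andP[bS cS] := cl' a b c ab bc ac aS.
have /andP[_ dS] := cl' a b d ab bd ad aS.
have /andP[fS gS] := cl' a f g af fg ag aS.
have /andP[_ hS] := cl' a f h af fh ah aS.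
apply/subsetP=> u; rewrite !inE.
by do 6?[case/orP=> [/eqP -> //|]]; move/eqP ->.
Qed.

Hypothesis e_sparse : sparse e.

(** Seven vertices with ten edges have excess 0, and a triangle leaving them would make it
    negative. *)
Lemma DD_closed vs : is_DD e vs -> tclosed e setT (vset vs).
Proof.
move=> dd; have c7 := card_DD dd.
have f : 20 <= e2 e (vset vs).
  by case/and3P: dd => _ uv Ev; exact: (e2_seq e_sym uv (isT : uniq DD_edges) Ev).
apply: (tclosed_steps e_sym); apply/negP.
  case/step1P=> v [a [b [[_ aS bS] [vS va vb ab]]]].
  have := e2_step1 e_sym e_irr vS aS bS va vb ab.
  have := sparseP e_sparse (S := v |: vset vs); rewrite cards_add // c7 => /(_ isT).
  by move: f; clear; lia.
case/step2P=> v [w [s [[_ _ sS] [vS wS vw sv sw]]]].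
have := e2_step2 e_sym e_irr vS wS sS vw sv sw.
have w' : w \notin v |: vset vs by rewrite in_setU1 negb_or wS andbT eq_sym (neq_of_edge e_irr).
have := sparseP e_sparse (S := w |: (v |: vset vs)); rewrite !cards_add // c7 => /(_ isT).
by move: f; clear; lia.
Qed.

(** Six vertices are too few for another copy of [DD]. *)
Lemma DD_minus_vertex vs v : is_DD e vs -> v \in vset vs -> matchable e (vset vs :\ v).
Proof.
move=> dd vv; apply: sparse_matchable => // vs' dd'.
apply/negP=> /subset_leq_card; rewrite (card_DD dd').
by move: (cardsD1 v (vset vs)); rewrite vv (card_DD dd); case: #|_| => [|[|[|[|[|[|[|]]]]]]].
Qed.

(** By closure under triangles, a common vertex would force one copy into the other, and both have
    seven vertices. *)
Lemma DD_disjoint vs vs' : is_DD e vs -> is_DD e vs' -> vset vs != vset vs' ->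
  [disjoint vset vs & vset vs'].
Proof.
move=> dd dd' ne; rewrite -setI_eq0; apply: contraNT ne => /set0Pn[x].
rewrite !in_setI => /andP[xv xv']; rewrite eq_sym eqEcard !card_DD // leqnn andbT.
by apply: (tclosed_DD (DD_closed dd) dd' (x := x)) => //; move: xv'; rewrite inE.
Qed.

(** Eleven edges on seven vertices are too many, so copies are induced. Hence a copy, although
    defined by its edges, is determined by its vertex set. *)
Lemma copy_edges_sparse phi : embeddingb DD e phi -> copy_edges DD phi =
  [set p | [&& p.1 \in phi @: setT, p.2 \in phi @: setT & e p.1 p.2]].
Proof.
move=> emb; have /embeddingP[inj H] := emb.
apply/setP=> p; rewrite inE; apply/imsetP/and3P => [[[i j]]|[]].
  by rewrite inE => /= ij -> /=; split; rewrite ?imset_f ?inE // H.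
case: p => a b /= /imsetP[i _ ->] /imsetP[j _ ->] eij.
exists (i, j) => //; rewrite inE /=.
have /and3P[/eqP s7 uv Ev] := embedding_is_DD emb.
have lt : 10 * size (codom phi) < 7 * (size DD_edges).+1 by rewrite s7.
have := @edges_exact _ _ e_sym e_irr e_sparse (phi ord0) _ DD_edges uv _ isT Ev lt i j.
by rewrite s7 !nth_codom_ord; apply; rewrite ?ltn_ord.
Qed.

Lemma contains_1P : reflect (exists phi, embeddingb DD e phi) (contains_k_copies DD 1 e).
Proof.
apply: (iffP existsP) => [[S /andP[/card_gt0P[B BS] /forall_inP/(_ B BS)]]|[phi emb]].
  by case/existsP=> phi /andP[emb _]; exists phi.
exists [set copy_edges DD phi]; rewrite cards1 /=; apply/forall_inP=> B.
by rewrite inE => /eqP ->; apply/existsP; exists phi; rewrite emb eqxx.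
Qed.

Lemma contains_2P : reflect (exists phi psi, [/\ embeddingb DD e phi, embeddingb DD e psi &
  copy_edges DD phi != copy_edges DD psi]) (contains_k_copies DD 2 e).
Proof.
apply: (iffP existsP) => [[S /andP[S2 /forall_inP H]]|[phi [psi [emb emb' ne]]]].
  have /card_gt1P[B [C [BS CS BC]]] := S2.
  have /existsP[phi /andP[emb /eqP EB]] := H B BS.
  have /existsP[psi /andP[emb' /eqP EC]] := H C CS.
  by exists phi, psi; rewrite -EB -EC.
exists [set copy_edges DD phi; copy_edges DD psi]; rewrite cards2 ne /=; apply/forall_inP=> B.
by rewrite !inE => /orP[] /eqP ->; apply/existsP; [exists phi|exists psi]; rewrite ?emb ?emb' eqxx.
Qed.

Lemma DD_board phi : embeddingb DD e phi ->
  odd #|phi @: setT| /\ ewin_aux e true #|phi @: setT| set0 (phi @: setT).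
Proof.
case/embeddingP=> inj H; rewrite card_imset // cardsT card_ord; split=> //.
by have := ewin_embed inj H Enforcer_wins_DD; rewrite imset0.
Qed.

Lemma no_DD_matchable W :
  (forall phi, embeddingb DD e phi -> ~~ (phi @: setT \subset W)) -> matchable e W.
Proof.
move=> H; apply: sparse_matchable => // vs /is_DD_embedding[phi emb <-]; exact: H.
Qed.

Lemma sparse_EA : EA_K3 e = contains_k_copies DD 1 e.
Proof.
apply/idP/contains_1P => [win|[phi emb]].
  have [[phi emb]|no] := @existsP _ (fun phi : {ffun 'I_7 -> T} => embeddingb DD e phi).
    by exists phi.
  suff : ~~ EA_K3 e by rewrite win.
  apply: matchable_not_EA; apply: no_DD_matchable => phi emb.
  by case: no; exists phi.
apply: (@Enforcer_boards_start _ e unit (fun=> phi @: setT) tt) => [[] []//|_|].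
  exact: DD_board.
(* One board of seven vertices flips the parity of the outside, as Avoider being last requires. *)
rewrite (eq_bigr (fun=> phi @: setT)) // big_const card_unit /= setU0.
rewrite -(cardsC (phi @: setT)) oddD; have [-> _] := DD_board emb.
by [].
Qed.

Lemma sparse_EE : EE_K3 e = contains_k_copies DD 2 e.
Proof.
apply/idP/contains_2P => [win|[phi [psi [emb emb' ne]]]]; last first.
  pose D b := if b then phi @: setT else psi @: setT.
  have nePP : vset (codom phi) != vset (codom psi).
    by apply: contraNneq ne; rewrite !vset_codom !copy_edges_sparse // => ->.
  have dis := DD_disjoint (embedding_is_DD emb) (embedding_is_DD emb') nePP.
  rewrite !vset_codom in dis.
  apply: (@Enforcer_boards_start _ e bool D true) => [[] [] //= _||].
  - by rewrite disjoint_sym.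
  - by case; apply: DD_board.
  (* Two boards of seven vertices leave the parity of the outside unchanged, as Enforcer being last
     requires. *)
  rewrite -(cardsC (\bigcup_i D i)) oddD; congr (_ (+) _).
  rewrite big_bool /= cardsU.
  move: dis; rewrite -setI_eq0 => /eqP ->; rewrite cards0 subn0 oddD.
  by have [-> _] := DD_board emb; have [-> _] := DD_board emb'.
have [[phi emb]|no] := @existsP _ (fun phi : {ffun 'I_7 -> T} => embeddingb DD e phi); last first.
  suff : ~~ EE_K3 e by rewrite win.
  apply: matchable_not_EE; apply: no_DD_matchable => phi emb.
  by case: no; exists phi.
have [[psi /andP[emb' ne]]|same] := @existsP _ (fun psi : {ffun 'I_7 -> T} =>
    embeddingb DD e psi && (copy_edges DD phi != copy_edges DD psi)).
  by exists phi, psi.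
suff : ~~ EE_K3 e by rewrite win.
have dd := embedding_is_DD emb; set D := vset (codom phi).
(* A copy outside [D] has the same edges as [phi], so its vertex [psi ord0] would also lie in
   [D]. *)
have [P [s [PD sP HP]]] : matchable e (~: D).
  apply: no_DD_matchable => psi emb'; apply/negP=> sub; case: same.
  exists psi; rewrite emb'; apply/negP=> /eqP E.
  have : (psi ord0, psi (inord 1)) \in copy_edges DD psi.
    by apply/imsetP; exists (ord0, inord 1); rewrite // inE /DD /= inordK.
  rewrite -E copy_edges_sparse // inE => /andP[/= in1 _].
  have /(subsetP sub) : psi ord0 \in psi @: setT by rewrite imset_f.
  by rewrite inE /D vset_codom in1.
have cl := DD_closed dd.
apply: (core_not_EE (D := D) sP); first by rewrite (card_DD dd).
  by rewrite disjoints_subset.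
move=> v vD; have [Q [s' [QD s'Q HQ]]] := DD_minus_vertex dd vD.
exists Q, s'; split=> // x y z xv yv zv e1 e2' e3.
have [xD|xD] := boolP (x \in D).
  have /andP[yD zD] := cl x y z xD (in_setT _) (in_setT _) e1 e2' e3.
  by right; apply: HQ; rewrite // in_setD1 ?xv ?yv ?zv.
have yD : y \notin D.
  apply: contra xD => yD; have := cl y x z yD (in_setT _) (in_setT _).
  by rewrite e_sym e3 e2' => /(_ e1 isT isT) /andP[].
have zD : z \notin D.
  apply: contra xD => zD; have := cl z x y zD (in_setT _) (in_setT _).
  by rewrite e_sym e3 e1 (e_sym z y) e2' => /(_ isT isT isT) /andP[].
by left; apply: HP; rewrite ?in_setC.
Qed.

End SparseGame.

(** * The random graph process *)

Lemma card_perm_type (T : finType) : #|{perm T}| = #|T|`!.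
Proof.
rewrite -[in RHS]cardsT -(card_perm [set: T]); apply: eq_card => p; rewrite !inE.
by apply/esym/subsetP => x; rewrite inE.
Qed.

(** * Permutations mapping given elements into a given set *)

Section PermCount.

Variables (T : finType) (B : {set T}).
Implicit Types (A : {set T}) (p : {perm T}).

Definition into A p : bool := [forall f in A, p f \in B].
(** If [B] is the set of the first positions, this is, up to division by the number of permutations,
    the probability that all edges of [A] have already been added. *)
Definition pcnt A : nat := #|[set p | into A p]|.

(** Composition with the transposition of [f] and [g] is a bijection between the two sets of
    permutations. *)
Lemma pcnt_swap A f g : f \notin A -> g \notin A -> pcnt (f |: A) = pcnt (g |: A).
Proof.
move=> fA gA; rewrite /pcnt -(card_imset _ (mulgI (tperm f g))).
apply: eq_card => p; apply/imsetP/idP => [[r rI ->]|].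
  move: rI; rewrite !inE => /forall_inP H; apply/forall_inP => x.
  rewrite !inE permM => /orP[/eqP ->|xA].
    by rewrite tpermR; apply: H; rewrite !inE eqxx.
  rewrite tpermD; first by apply: H; rewrite !inE xA orbT.
    by apply: contraNneq fA => ->.
  by apply: contraNneq gA => ->.
rewrite inE => /forall_inP H; exists (tperm f g * p)%g; last by rewrite mulgA tperm2 mul1g.
rewrite inE; apply/forall_inP => x; rewrite !inE permM => /orP[/eqP ->|xA].
  by rewrite tpermL; apply: H; rewrite !inE eqxx.
rewrite tpermD; first by apply: H; rewrite !inE xA orbT.
  by apply: contraNneq fA => ->.
by apply: contraNneq gA => ->.
Qed.

Lemma into_setU1 A f p : into (f |: A) p = (p f \in B) && into A p.
Proof.
apply/forall_inP/andP => [H|[fB /forall_inP H] x].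
  split; first by apply: H; rewrite !inE eqxx.
  by apply/forall_inP=> x xA; apply: H; rewrite !inE xA orbT.
by rewrite !inE => /orP[/eqP -> //|/H].
Qed.

Lemma into_setU A A' p : into (A :|: A') p = into A p && into A' p.
Proof.
apply/forall_inP/andP => [H|[/forall_inP H /forall_inP H'] x].
  by split; apply/forall_inP=> x xA; apply: H; rewrite inE xA ?orbT.
by rewrite inE => /orP[/H|/H'].
Qed.

Lemma pcnt_sum A : pcnt A = \sum_p into A p.
Proof. by rewrite /pcnt cardsE -sum1_card big_mkcond. Qed.

(* Count the pairs (p, g) with g outside A and p mapping A and g into B. *)
Lemma pcnt_step A f : f \notin A ->
  pcnt (f |: A) * (#|T| - #|A|) = pcnt A * (#|B| - #|A|).
Proof.
move=> fA.
have -> : pcnt (f |: A) * (#|T| - #|A|) = \sum_(g in ~: A) pcnt (g |: A).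
  rewrite (eq_bigr (fun=> pcnt (f |: A))) => [|g].
    by rewrite sum_nat_const (cardsCs (~: A)) setCK mulnC.
  by rewrite inE => gA; apply: pcnt_swap.
under eq_bigr do rewrite pcnt_sum.
rewrite exchange_big pcnt_sum big_distrl /=; apply: eq_bigr => p _.
case pA: (into A p); last first.
  by rewrite mul0n big1 // => g _; rewrite into_setU1 pA andbF.
rewrite mul1n (eq_bigr (fun g => nat_of_bool (g \in p @^-1: B))) => [|g _]; last first.
  by rewrite into_setU1 pA andbT inE.
rewrite -big_mkcondr sum1_card -(card_preimset B (@perm_inj _ p)).
have AB : A \subset p @^-1: B.
  by apply/subsetP=> x xA; rewrite inE; move/forall_inP: pA; apply.
rewrite -[X in _ - X](_ : #|(p @^-1: B) :&: A| = _); last by rewrite (setIidPr AB).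
by rewrite -cardsD; apply: eq_card => x; rewrite unfold_in !inE.
Qed.

(** The hypergeometric probability, cleared of denominators. *)
Lemma pcntE A : pcnt A * #|T| ^_ #|A| = #|T|`! * #|B| ^_ #|A|.
Proof.
move Ek: #|A| => k; elim: k A Ek => [|k IH] A Ek.
  rewrite !ffactn0 !muln1 (cards0_eq Ek) -card_perm_type.
  by apply: eq_card => p; rewrite !inE; apply/forall_inP => x; rewrite inE.
have /card_gt0P[f fA] : 0 < #|A| by rewrite Ek.
have EA : A = f |: (A :\ f) by rewrite setD1K.
have Ek' : #|A :\ f| = k by move: Ek; rewrite (cardsD1 f) fA => -[].
have := @pcnt_step (A :\ f) f; rewrite !inE eqxx -EA Ek' => /(_ isT) step.
by rewrite !ffactnSr mulnCA step mulnA (mulnC _ (pcnt _)) IH // mulnA.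
Qed.

(** Factor by factor, [(M - i) / (N - i)] is at most [M / N]. *)
Lemma ffact_ratio M N k : M <= N -> M ^_ k * N ^ k <= M ^ k * N ^_ k.
Proof.
move=> MN; elim: k => [|k IH]; first by rewrite !ffactn0 !expn0.
rewrite !ffactnSr !expnSr mulnACA [X in _ <= X]mulnACA.
apply: leq_mul IH _; rewrite mulnBr mulnBl leq_sub2l //.
by rewrite mulnC leq_mul2l MN orbT.
Qed.

Lemma pcnt_le A k : #|B| <= #|T| -> k <= #|A| ->
  pcnt A * #|T| ^ k <= #|T|`! * #|B| ^ k.
Proof.
move=> BT kA.
have [T0|T0] := posnP #|T|.
  have A0 : #|A| = 0 by apply/eqP; rewrite -leqn0 -T0 max_card.
  have k0 : k = 0 by apply/eqP; rewrite -leqn0 -A0.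
  have := pcntE A; rewrite A0 k0 !ffactn0 !expn0 !muln1 => ->; exact: leqnn.
have h : pcnt A * #|T| ^ #|A| <= #|T|`! * #|B| ^ #|A|.
  rewrite -(@leq_pmul2r (#|T| ^_ #|A|)) ?ffact_gt0 ?max_card //.
  rewrite mulnAC pcntE -!mulnA leq_mul2l; apply/orP; right.
  exact: ffact_ratio.
have e1 : #|A| = k + (#|A| - k) by rewrite subnKC.
rewrite -(@leq_pmul2r (#|T| ^ (#|A| - k))) ?expn_gt0 ?T0 //.
rewrite -mulnA -expnD -e1; apply: leq_trans h _.
rewrite {1}e1 expnD mulnA leq_mul2l; apply/orP; right.
by case: (#|A| - k) => [|d]; rewrite ?expn0 // leq_exp2r.
Qed.

End PermCount.

Lemma leq_sum_of_mul (I : finType) (P : pred I) (X : I -> nat) (m Y : nat) :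
  0 < m -> #|P| <= m -> (forall i, P i -> m * X i <= Y) -> \sum_(i | P i) X i <= Y.
Proof.
move=> m0 Pm H; rewrite -(leq_pmul2l m0) big_distrr /=.
apply: (@leq_trans (\sum_(i | P i) Y)); first exact: leq_sum.
by rewrite sum_nat_const leq_mul2r Pm orbT.
Qed.

Lemma ffact_le_expn n k : n ^_ k <= n ^ k.
Proof.
elim: k => [|k IH]; first by rewrite ffactn0 expn0.
by rewrite ffactnSr expnSr leq_mul // leq_subr.
Qed.

Lemma bin_le_expn n k : 'C(n, k) <= n ^ k.
Proof.
apply: leq_trans (ffact_le_expn n k); rewrite -bin_ffact leq_pmulr //; exact: fact_gt0.
Qed.

Lemma proc_graph_sym n (p : {perm Kedge n}) i : symmetric (proc_graph p i).
Proof. by move=> x y; apply: eq_existsb => f; rewrite orbC. Qed.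

Lemma proc_graph_irr n (p : {perm Kedge n}) i : irreflexive (proc_graph p i).
Proof.
move=> x; apply/existsP=> -[f /andP[]]; rewrite orbb => /eqP E _.
by have := valP f; rewrite E /= ltnn.
Qed.

Lemma proc_graph_mono n (p : {perm Kedge n}) i j x y : i <= j ->
  proc_graph p i x y -> proc_graph p j x y.
Proof.
move=> ij /existsP[f /andP[E r]]; apply/existsP; exists f; rewrite E.
exact: leq_trans r ij.
Qed.

Lemma sub_sparse (T : finType) (e e' : rel T) : subrel e e' -> sparse e' -> sparse e.
Proof.
move=> ee /forallP H; apply/forallP=> S; apply/implyP=> cS.
apply: leq_trans (implyP (H S) cS); rewrite leq_mul2l; apply/orP; right.
apply/subset_leq_card/subsetP=> p; rewrite !inE => /and3P[-> ->]; exact: ee.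
Qed.

Lemma sub_contains_2 (T : finType) (e e' : rel T) : subrel e e' ->
  contains_k_copies DD 2 e -> contains_k_copies DD 1 e'.
Proof.
move=> ee /contains_2P[phi [_ [/embeddingP[inj H] _ _]]]; apply/contains_1P.
by exists phi; apply/embeddingP; split=> // i j /H /ee.
Qed.

(** * Union bound for sparseness *)

Section Edges.

Variable n : nat.
Local Notation K := (Kedge n).

Lemma card_Kedge_ge : n * n <= 2 * #|K| + n.
Proof.
pose D := [set (x, x) | x in [set: 'I_n]].
pose L := [set val f | f in [set: K]]; pose R := [set ((val f).2, (val f).1) | f in [set: K]].
have : #|[set: 'I_n * 'I_n]| <= #|L :|: R :|: D|.
  apply/subset_leq_card/subsetP=> -[x y] _; rewrite !inE.
  case: (ltngtP x y) => xy.
  - apply/orP; left; apply/orP; left; apply/imsetP.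
    by exists (exist (fun z : 'I_n * 'I_n => z.1 < z.2) (x, y) xy : K).
  - apply/orP; left; apply/orP; right; apply/imsetP.
    by exists (exist (fun z : 'I_n * 'I_n => z.1 < z.2) (y, x) xy : K).
  - by apply/orP; right; apply/imsetP; exists x => //; rewrite (val_inj xy).
rewrite cardsT card_prod card_ord => h.
have cL : #|L| <= #|K| by rewrite -cardsT leq_imset_card.
have cR : #|R| <= #|K| by rewrite -cardsT leq_imset_card.
have cD : #|D| <= n.
  by have := leq_imset_card (fun x : 'I_n => (x, x)) [set: 'I_n]; rewrite cardsT card_ord.
have [h1 _] := leq_card_setU (L :|: R) D; have [h2 _] := leq_card_setU L R.
apply: leq_trans h (leq_trans h1 (leq_add _ cD)).
by rewrite mul2n -addnn; apply: leq_trans h2 (leq_add cL cR).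
Qed.

Lemma card_Kedge_le : #|K| <= n * n.
Proof. by rewrite card_sub -[n in n * n]card_ord -card_prod max_card. Qed.

Definition Kset (S : {set 'I_n}) : {set K} := [set f : K | ((val f).1 \in S) && ((val f).2 \in S)].

Lemma card_Kset S : #|Kset S| <= #|S| * #|S|.
Proof.
rewrite -(card_imset _ val_inj) -cardsX; apply/subset_leq_card/subsetP=> _ /imsetP[f + ->].
by rewrite !inE.
Qed.

Variable M : nat.
(** These are positions: edge [f] belongs to the graph at time [M] iff [p f] is in this set. *)
Definition early : {set K} := [set f : K | enum_rank f < M].

Lemma card_early : M <= #|K| -> #|early| = M.
Proof.
move=> MK; rewrite -(card_imset _ enum_rank_inj).
have -> : enum_rank @: early = [set widen_ord MK i | i in [set: 'I_M]].
  apply/setP=> i; apply/imsetP/imsetP => [[f]|[j _ ->]].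
    by rewrite inE => fM ->; exists (Ordinal fM); rewrite ?inE //; apply/val_inj.
  by exists (enum_val (widen_ord MK j)); rewrite ?inE enum_valK //=.
by rewrite card_imset ?cardsT ?card_ord // => i j /(congr1 val) /= /val_inj.
Qed.

Lemma proc_graph_early (p : {perm K}) x y : proc_graph p M x y =
  [exists f : K, ((val f == (x, y)) || (val f == (y, x))) && (p f \in early)].
Proof. by apply: eq_existsb => f; rewrite inE. Qed.

Lemma e2_proc_graph (p : {perm K}) S :
  e2 (proc_graph p M) S <= 2 * #|[set f in Kset S | p f \in early]|.
Proof.
set E := [set f in _ | _].
pose R := [set ((val f).2, (val f).1) | f in E].
have : e2 (proc_graph p M) S <= #|[set val f | f in E] :|: R|.
  apply/subset_leq_card/subsetP=> -[x y]; rewrite !inE /= => /and3P[xS yS].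
  rewrite proc_graph_early => /existsP[f /andP[/orP[]/eqP Ef pf]].
    by apply/orP; left; apply/imsetP; exists f => //; rewrite inE pf andbT inE Ef /= xS yS.
  by apply/orP; right; apply/imsetP; exists f; rewrite ?Ef // inE pf andbT inE Ef /= xS yS.
move=> h; have [h1 _] := leq_card_setU [set val f | f in E] R.
have h2 := leq_imset_card val E; have h3 := leq_imset_card (fun f : K => ((val f).2, (val f).1)) E.
rewrite mul2n -addnn; exact: leq_trans h (leq_trans h1 (leq_add h2 h3)).
Qed.

(* The least number of edges that makes v vertices too dense. *)
Definition kden v : nat := ((10 * v) %/ 7).+1.

Lemma not_sparse_witness (p : {perm K}) : ~~ sparse (proc_graph p M) ->
  exists (S : {set 'I_n}) (A : {set K}), [/\ #|S| < 24, A \subset Kset S, #|A| = kden #|S| & into early A p].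
Proof.
rewrite negb_forall => /existsP[S]; rewrite negb_imply -ltnNge => /andP[cS lt].
set E := [set f in Kset S | p f \in early].
(* Each edge contributes at most two ordered pairs, so the failing density bound gives
   [7 * #|E| > 10 * #|S|]. *)
have kE : kden #|S| <= #|E|.
  have := e2_proc_graph p S; rewrite -/E /kden; move: lt; clear; lia.
exists S, [set f in take (kden #|S|) (enum E)].
have sub f : f \in take (kden #|S|) (enum E) -> f \in E by move=> /mem_take; rewrite mem_enum.
split=> //.
- by apply/subsetP=> f; rewrite inE => /sub; rewrite inE => /andP[].
- rewrite cardsE (card_uniqP _) ?take_uniq ?enum_uniq // size_takel // -cardE.
  exact: kE.
- by apply/forall_inP=> f; rewrite inE => /sub; rewrite inE => /andP[].
Qed.

Lemma card_not_sparse : #|[set p : {perm K} | ~~ sparse (proc_graph p M)]| <=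
  \sum_(S : {set 'I_n} | #|S| < 24)
    \sum_(A : {set K} | (A \subset Kset S) && (#|A| == kden #|S|)) pcnt early A.
Proof.
have -> : \sum_(S : {set 'I_n} | #|S| < 24)
    \sum_(A : {set K} | (A \subset Kset S) && (#|A| == kden #|S|)) pcnt early A =
  \sum_(p : {perm K}) \sum_(S : {set 'I_n} | #|S| < 24)
    \sum_(A : {set K} | (A \subset Kset S) && (#|A| == kden #|S|)) into early A p.
  rewrite [RHS]exchange_big /=; apply: eq_bigr => S _.
  by rewrite [RHS]exchange_big /=; apply: eq_bigr => A _; rewrite pcnt_sum.
rewrite -sum1_card big_mkcond /=; apply: leq_sum => p _; rewrite inE.
case: ifP => // /not_sparse_witness[S [A [cS AS /eqP cA iA]]].
rewrite (bigD1 S) //= (bigD1 A) /= ?AS ?cA // iA; lia.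
Qed.

(** There are 24 sizes, at most [n ^ v] vertex sets of size [v], and at most [2 ^ (23 * 23)] edge
    sets inside each; the hypothesis bounds the expected contribution of each size. *)
Lemma not_sparse_bound s c : 0 < n -> 0 < #|K| -> M <= #|K| ->
  (forall v, v < 24 -> n ^ v * M ^ kden v * s <= c * #|K| ^ kden v) ->
  s * #|[set p : {perm K} | ~~ sparse (proc_graph p M)]| <= 24 * (2 ^ (23 * 23) * (c * #|K|`!)).
Proof.
move=> n0 K0 MK H.
have oneA (S : {set 'I_n}) (A : {set K}) : #|S| < 24 -> #|A| = kden #|S| -> n ^ #|S| * (s * pcnt early A) <= c * #|K|`!.
  move=> cS cA; rewrite -(@leq_pmul2r (#|K| ^ kden #|S|)) ?expn_gt0 ?K0 //.
  have h := @pcnt_le _ early A (kden #|S|); rewrite card_early // cA leqnn in h.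
  have {}h := h MK isT.
  apply: (@leq_trans (n ^ #|S| * s * (#|K|`! * M ^ kden #|S|))).
    by rewrite -!mulnA !leq_mul2l h !orbT.
  have := leq_mul (H _ cS) (leqnn #|K|`!).
  rewrite -!mulnA [M ^ _ * _]mulnCA [M ^ _ * _]mulnC [_ ^ _ * #|K|`!]mulnC.
  by rewrite !mulnA.
have oneS (S : {set 'I_n}) : #|S| < 24 -> n ^ #|S| * (s * \sum_(A : {set K} | (A \subset Kset S) && (#|A| == kden #|S|)) pcnt early A)
    <= 2 ^ (23 * 23) * (c * #|K|`!).
  move=> cS; rewrite mulnA big_distrr /=.
  apply: (@leq_trans (\sum_(A : {set K} | (A \subset Kset S) && (#|A| == kden #|S|)) c * #|K|`!)).
    by apply: leq_sum => A /andP[_ /eqP cA]; rewrite -mulnA; apply: oneA.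
  rewrite sum_nat_const leq_mul2r; apply/orP; right.
  apply: (@leq_trans #|powerset (Kset S)|).
    by apply/subset_leq_card/subsetP=> A; rewrite !inE => /andP[].
  rewrite card_powerset leq_exp2l //; apply: leq_trans (card_Kset S) _.
  by apply: leq_mul; rewrite -ltnS.
apply: leq_trans (leq_mul (leqnn s) card_not_sparse) _.
rewrite big_distrr /= (partition_big (fun S : {set 'I_n} => inord #|S| : 'I_24) xpredT) //=.
rewrite -[X in _ <= X * _](card_ord 24) -sum_nat_const; apply: leq_sum => v _.
have nv0 : 0 < n ^ v by rewrite expn_gt0 n0.
apply: (leq_sum_of_mul nv0) => [|S /andP[cS /eqP Ev]].
  apply: leq_trans (bin_le_expn n v).
  rewrite -[n in 'C(n, v)]card_ord -card_draws.
  by apply/subset_leq_card/subsetP=> S; rewrite !inE => /andP[cS /eqP <-]; rewrite inordK.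
have := oneS S cS; suff -> : #|S| = v by [].
by rewrite -Ev inordK.
Qed.

End Edges.

(** * Placements of the double diamond into blocks *)

Definition DDo : seq ('I_7 * 'I_7) := [seq (inord p.1, inord p.2) | p <- DD_edges].

Lemma DD_edges_lt p : p \in DD_edges -> (p.1 < p.2) && (p.2 < 7).
Proof. by move: p; apply/allP. Qed.

Lemma mem_DDo (i j : 'I_7) : ((i, j) \in DDo) = ((val i, val j) \in DD_edges).
Proof.
apply/mapP/idP => [[p pD [-> ->]]|ijD].
  have /andP[p12 p7] := DD_edges_lt pD.
  by rewrite /= !inordK // ?(ltn_trans p12 p7) // -surjective_pairing.
by exists (val i, val j) => //=; rewrite !inord_val.
Qed.

Lemma size_DDo : size DDo = 10. Proof. by []. Qed.

Lemma uniq_DDo : uniq DDo.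
Proof.
rewrite map_inj_in_uniq // => p q pD qD [].
have /andP[p12 p7] := DD_edges_lt pD; have /andP[q12 q7] := DD_edges_lt qD.
have [p7' q7'] := (ltn_trans p12 p7, ltn_trans q12 q7).
move=> /(congr1 val); rewrite /= !inordK // => e1.
move=> /(congr1 val); rewrite /= !inordK // => e2'.
by rewrite (surjective_pairing p) (surjective_pairing q) e1 e2'.
Qed.

Definition eJ (J : {set 'I_7}) : nat := count (fun p => (p.1 \in J) && (p.2 \in J)) DDo.

(** [DD] is balanced: no subgraph is denser than the whole. All 128 vertex subsets are checked. *)
Lemma eJ_dense (J : {set 'I_7}) : 7 * eJ J <= 10 * #|J|.
Proof.
have -> : #|J| = \sum_(0 <= i < 7) (inord i \in J).
  rewrite big_mkord -sum1_card big_mkcond /=; apply: eq_bigr => i _.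
  by rewrite inord_val; case: (i \in J).
rewrite /eJ /DDo count_map !big_nat_recl // big_geq //=.
case: (inord 0 \in J); case: (inord 1 \in J); case: (inord 2 \in J); case: (inord 3 \in J);
by case: (inord 4 \in J); case: (inord 5 \in J); case: (inord 6 \in J).
Qed.

(** Removing [t] from both arguments decreases each ratio of factors; this is the negative
    correlation of disjoint edge sets. *)
Lemma ffact_shift M N t k : M <= N -> (M - t) ^_ k * N ^_ k <= M ^_ k * (N - t) ^_ k.
Proof.
move=> MN; elim: k => [|k IH]; first by rewrite !ffactn0.
rewrite !ffactnSr mulnACA [X in _ <= X]mulnACA; apply: leq_mul IH _.
have [Mk|Mk] := leqP M (t + k).
  by have -> : M - t - k = 0 by move: Mk; clear; lia.
have [a Ea] : exists a, M = t + k + a by exists (M - (t + k)); move: Mk; clear; lia.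
have [b Eb] : exists b, N = M + b by exists (N - M); move: MN; clear; lia.
rewrite Eb Ea; have -> : t + k + a - t - k = a by lia.
have -> : t + k + a + b - t - k = a + b by lia.
have -> : t + k + a + b - k = t + a + b by lia.
have -> : t + k + a - k = t + a by lia.
by nia.
Qed.

(** For [M >= 18] each factor [M - i] with [i <= 9] is at least half of [M]. *)
Lemma ffact10_lower M : 18 <= M -> M ^ 10 <= 2 ^ 10 * M ^_ 10.
Proof.
move=> M18.
have h : forall k, k <= 10 -> M ^ k <= 2 ^ k * M ^_ k.
  elim=> [|k IH] k10; first by rewrite !expn0 ffactn0.
  rewrite !expnSr ffactnSr mulnACA; apply: leq_mul; first by apply: IH; apply: ltnW.
  by move: M18 k10; clear; lia.
exact: h.
Qed.

(** The sum is a product over the seven coordinates; in each, the agreeing value contributes [m] and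
    the others 1 each, at most [2 * m] together. *)
Lemma sum_expn_agree m (phi : {ffun 'I_7 -> 'I_m}) :
  \sum_(psi : {ffun 'I_7 -> 'I_m}) m ^ #|[set i | phi i == psi i]| <= (2 * m) ^ 7.
Proof.
have E (psi : {ffun 'I_7 -> 'I_m}) :
    m ^ #|[set i | phi i == psi i]| = \prod_(i < 7) (if phi i == psi i then m else 1).
  rewrite -big_mkcond /= prod_nat_const; congr (_ ^ _).
  by apply: eq_card => i; rewrite inE.
under eq_bigr do rewrite E.
rewrite -(bigA_distr_bigA (fun i a => if phi i == a then m else 1)) /=.
have -> : (2 * m) ^ 7 = \prod_(i < 7) (2 * m) by rewrite prod_nat_const card_ord.
apply: leq_prod => i _.
rewrite (bigD1 (phi i)) //= eqxx (eq_bigr (fun=> 1)) => [|a ap]; last first.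
  by rewrite eq_sym (negbTE ap).
rewrite mul2n -addnn leq_add2l sum1_card -[X in _ <= X]card_ord; exact: max_card.
Qed.

Section Transversal.

Variables (n m : nat).
Hypothesis mn : 7 * m <= n.
Local Notation K := (Kedge n).
Local Notation fn := {ffun 'I_7 -> 'I_m}.
Implicit Types phi psi : fn.

Lemma emb_proof phi (i : 'I_7) : i * m + phi i < n.
Proof.
apply: leq_trans mn; apply: (@leq_trans (i * m + m)); first by rewrite ltn_add2l.
by rewrite addnC -mulSn leq_mul2r ltn_ord orbT.
Qed.

(* Vertex i of DD is placed in the i-th of seven disjoint blocks of m vertices. *)
Definition emb phi (i : 'I_7) : 'I_n := Ordinal (emb_proof phi i).

Lemma emb_eq phi psi i j : emb phi i = emb psi j -> i = j /\ phi i = psi i.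
Proof.
move=> /(congr1 val) /= E.
have ij : i = j.
  apply: val_inj => /=; have m0 : 0 < m by apply: leq_trans (ltn_ord (phi i)).
  have := congr1 (fun k => k %/ m) E.
  by rewrite !divnMDl // !divn_small // !addn0.
split=> //; subst j; apply: val_inj => /=; move: E => /eqP; rewrite eqn_add2l.
by move/eqP.
Qed.

Lemma emb_lt phi psi (i j : 'I_7) : i < j -> emb phi i < emb psi j.
Proof.
move=> ij /=; apply: (@leq_trans (i * m + m)); first by rewrite ltn_add2l.
rewrite addnC -mulSn; apply: leq_trans (leq_addr _ _).
by rewrite leq_mul2r ij orbT.
Qed.

Definition epairs phi := [seq (emb phi p.1, emb phi p.2) | p <- DDo].
Definition eset phi : {set K} := [set f : K | val f \in epairs phi].

Lemma val_eset phi : val @: eset phi = [set z in epairs phi].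
Proof.
apply/setP=> z; rewrite inE; apply/imsetP/idP => [[f + ->]|zp]; first by rewrite inE.
have /mapP[[i j] ij Ez] := zp.
have lt : z.1 < z.2.
  rewrite Ez; apply: emb_lt; move: ij; rewrite mem_DDo => /DD_edges_lt /andP[]; done.
by exists (exist (fun z : 'I_n * 'I_n => z.1 < z.2) z lt : K); rewrite // inE.
Qed.

Lemma card_eset phi : #|eset phi| = 10.
Proof.
rewrite -(card_imset _ val_inj) val_eset cardsE (card_uniqP _) ?size_map //.
rewrite map_inj_in_uniq ?uniq_DDo // => -[i j] [i' j'] _ _ E.
by have /= /emb_eq[-> _] := congr1 fst E; have /= /emb_eq[-> _] := congr1 snd E.
Qed.

Definition agree phi psi : {set 'I_7} := [set i | phi i == psi i].

(** The blocks are disjoint, so a common edge comes from the same edge of [DD], with agreement at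
    both ends. *)
Lemma card_esetI phi psi : #|eset phi :&: eset psi| <= eJ (agree phi psi).
Proof.
rewrite -(card_imset _ val_inj) /eJ -size_filter.
set F := filter _ _; rewrite -(size_map (fun p => (emb phi p.1, emb phi p.2)) F).
apply: leq_trans (card_size _); apply/subset_leq_card/subsetP=> z /imsetP[f].
rewrite in_setI !in_set => /andP[/mapP[[i j] ij E] /mapP[[i' j'] _ E']] ->.
rewrite E in E'; have /= /emb_eq[_ a1] := congr1 fst E'.
have /= /emb_eq[_ a2] := congr1 snd E'.
rewrite E; apply/mapP; exists (i, j) => //.
by rewrite mem_filter /= !in_set a1 a2 !eqxx ij.
Qed.

Lemma card_esetU phi psi : 20 - eJ (agree phi psi) <= #|eset phi :|: eset psi| <= 20.
Proof.
have := card_esetI phi psi; rewrite cardsU !card_eset.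
have : #|eset phi :&: eset psi| <= 10 by rewrite -(card_eset phi) subset_leq_card ?subsetIl.
clear; lia.
Qed.

Lemma two_esets_contains M (p : {perm K}) phi psi : phi != psi ->
  into (early n M) (eset phi) p -> into (early n M) (eset psi) p ->
  contains_k_copies DD 2 (proc_graph p M).
Proof.
move=> ne ip ip'.
have embed (chi : fn) : into (early n M) (eset chi) p ->
    embeddingb DD (proc_graph p M) [ffun i => emb chi i].
  move=> /forall_inP H; apply/embeddingP; split=> [i j|i j].
    by rewrite !ffunE => /emb_eq[].
  rewrite !ffunE proc_graph_early.
  have edge (i' j' : 'I_7) : (val i', val j') \in DD_edges -> exists2 f : K,
      val f = (emb chi i', emb chi j') & p f \in early n M.
    rewrite -mem_DDo => ij; have : (emb chi i', emb chi j') \in val @: eset chi.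
      by rewrite val_eset inE; apply/mapP; exists (i', j').
    by case/imsetP=> f fE ->; exists f => //; apply: H.
  by case/orP=> /edge[f Ef pf]; apply/existsP; exists f; rewrite Ef pf eqxx ?orbT.
apply/contains_2P; exists [ffun i => emb phi i], [ffun i => emb psi i]; split; try exact: embed.
apply: contraNneq ne => E; apply/eqP/ffunP => i.
(* [DD] has no isolated vertex, so the edge set of a copy determines the whole placement. *)
have [j ij] : exists j : 'I_7, DD i j.
  have [->|i0] := eqVneq i ord0; first by exists (inord 1); rewrite /DD /= inordK.
  exists ord0; move: i0; rewrite /DD /= -val_eqE /=.
  by case: i => -[|[|[|[|[|[|[|]]]]]]].
have : (emb phi i, emb phi j) \in copy_edges DD [ffun i => emb phi i].
  by apply/imsetP; exists (i, j); rewrite ?inE //= !ffunE.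
rewrite E => /imsetP[[i' j'] _ /= /(congr1 fst)]; rewrite /= ffunE.
by case/emb_eq.
Qed.

End Transversal.

(** * Second moment estimate for the number of copies *)

(** Chebyshev's inequality: the mean is at least 2, so [X p <= 1] deviates from it by at least half
    of it. *)
Lemma second_moment (O : finType) (X : O -> nat) (s C : nat) :
  let S1 := \sum_p X p in let S2 := \sum_p X p ^ 2 in
  0 < S1 -> 2 * #|O| <= S1 -> s * (#|O| * S2) <= (s + C) * S1 ^ 2 ->
  s * #|[set p | X p <= 1]| <= 4 * C * #|O|.
Proof.
move=> S1 S2 S10 h1 h2; set Y := [set p | X p <= 1].
pose w : rat := (#|O|%:R)%R; pose a : rat := (S1%:R)%R.
have w0 : (0 <= w)%R by apply: ler0n.
have key : (#|Y|%:R * a ^+ 2 <= 4 * (w * (w * S2%:R - a ^+ 2)))%R.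
  have -> : (w * (w * S2%:R - a ^+ 2) = \sum_(p : O) (w * (X p)%:R - a) ^+ 2 :> rat)%R.
    rewrite (eq_bigr (fun p => w ^+ 2 * ((X p ^ 2)%:R) - (2 * w * a) * (X p)%:R + a ^+ 2))%R.
      rewrite big_split /= sumrB -!mulr_sumr -!natr_sum sumr_const -/S1 -/S2 -mulr_natr -/w -/a.
      rewrite [#|_|](_ : _ = #|O|) //; ring.
    by move=> p _; rewrite natrX; ring.
  rewrite mulr_sumr [leLHS](_ : _ = \sum_(p in Y) a ^+ 2)%R; last first.
    by rewrite sumr_const mulr_natl.
  rewrite big_mkcond /=; apply: ler_sum => p _; case: ifP => [|_]; last first.
    by rewrite mulr_ge0 // sqr_ge0.
  rewrite inE => Xp.
  have x1 : ((X p)%:R <= 1 :> rat)%R by rewrite -[1%R]/(1%:R)%R ler_nat.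
  have x0 : (0 <= (X p)%:R :> rat)%R by apply: ler0n.
  have a2 : (2 * w <= a)%R by rewrite -natrM ler_nat.
  have wx : (w * (X p)%:R <= w)%R by rewrite -[leRHS]mulr1 ler_wpM2l.
  set t := (w * _)%R in wx *.
  (* As [t <= a / 2], this is the factored form of [4 (a - t)^2 >= a^2]. *)
  have : (0 <= (2 * (a - t) - a) * (2 * (a - t) + a))%R.
    by apply: mulr_ge0; lra.
  by rewrite -subr_ge0; congr (0 <= _)%R; ring.
have h2' : (s%:R * (w * S2%:R) <= (s%:R + C%:R) * a ^+ 2 :> rat)%R.
  by rewrite -natrX -natrD -!natrM ler_nat.
have a20 : (0 < a ^+ 2)%R by rewrite exprn_gt0 // ltr0n.
rewrite -(ler_nat rat) !natrM -/w -(ler_pM2r a20).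
have s0 : (0 <= s%:R :> rat)%R by apply: ler0n.
rewrite -[leLHS]mulrA; apply: (Order.POrderTheory.le_trans (ler_wpM2l s0 key)).
have := ler_wpM2l w0 h2'; rewrite -subr_ge0 => h3.
rewrite -subr_ge0 (_ : _ - _ = 4 * (w * ((s%:R + C%:R) * a ^+ 2) - w * (s%:R * (w * S2%:R))))%R.
  by rewrite mulr_ge0.
by ring.
Qed.

Lemma ffact_add k i j : k ^_ (i + j) = k ^_ i * (k - i) ^_ j.
Proof.
elim: j => [|j IH]; first by rewrite addn0 ffactn0 muln1.
by rewrite addnS !ffactnSr IH subnDA mulnA.
Qed.

Section SecondMoment.

Variables (n m M s a c3 : nat).
Local Notation K := (Kedge n).
Local Notation fn := {ffun 'I_7 -> 'I_m}.
Hypotheses (m0 : 0 < m) (mn : 7 * m <= n) (MN : M <= #|K|) (N20 : 20 <= #|K|).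
Hypothesis Ma : M ^ 10 <= a * M ^_ 10.
(** Up to constants, the expected number of placements of a subgraph with [v] vertices and [e] edges
    is at least [s]. *)
Hypothesis dens : forall e v, 7 * e <= 10 * v -> 0 < v -> v <= 7 ->
  s * #|K| ^ e <= c3 * (m ^ v * M ^ e).
Hypotheses (c30 : 0 < c3) (a0 : 0 < a) (s_big : 2 * (a * c3) <= s).

Local Notation N := #|K|.
Local Notation B := (early n M).
Local Notation es := (eset mn).
(** The chosen placement is arbitrary: the count depends only on the number 10 of edges. *)
Definition c10 : nat := pcnt B (es [ffun=> Ordinal m0]).

Lemma ffN_gt0 k : k <= 20 -> 0 < N ^_ k.
Proof. by move=> k20; rewrite ffact_gt0; apply: leq_trans N20. Qed.

Lemma c10E : c10 * N ^_ 10 = N`! * M ^_ 10.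
Proof.
by have := pcntE B (es [ffun=> Ordinal m0]); rewrite card_eset card_early.
Qed.

Lemma pcnt_eset (phi : fn) : pcnt B (es phi) = c10.
Proof.
apply/eqP; rewrite -(eqn_pmul2r (ffN_gt0 (isT : 10 <= 20))) c10E.
by have := pcntE B (es phi); rewrite card_eset card_early // => ->.
Qed.

(** The two edge sets are disjoint, hence negatively correlated. *)
Lemma pcnt_disagree (phi psi : fn) : agree phi psi = set0 ->
  N`! * pcnt B (es phi :|: es psi) <= c10 ^ 2.
Proof.
move=> J0; have e0 : eJ (agree phi psi) = 0.
  by rewrite J0 /eJ; apply/eqP; rewrite -leqn0 leqNgt -has_count; apply/hasPn => p _; rewrite !inE.
have c20 : #|es phi :|: es psi| = 20.
  by have := card_esetU mn phi psi; rewrite e0; clear; lia.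
have := pcntE B (es phi :|: es psi); rewrite c20 card_early // => E20.
have P20 := ffN_gt0 (leqnn 20); have P10 := ffN_gt0 (isT : 10 <= 20).
have := @ffact_shift M N 10 10 MN.
have s20 k : k ^_ 20 = k ^_ 10 * (k - 10) ^_ 10.
  by rewrite -[20]/(10 + 10) ffact_add.
have PP : 0 < N ^_ 10 * N ^_ 10 by rewrite muln_gt0 P10.
move=> sh; rewrite -(leq_pmul2r P20) -(leq_pmul2r PP).
rewrite -[X in X * (_ * _)]mulnA E20 {1}s20 [in X in _ <= X]s20.
have -> : c10 ^ 2 * (N ^_ 10 * (N - 10) ^_ 10) * (N ^_ 10 * N ^_ 10) =
    (c10 * N ^_ 10) * (c10 * N ^_ 10) * (N ^_ 10 * (N - 10) ^_ 10).
  by move: (N ^_ 10) ((N - 10) ^_ 10) c10 => x y z; ring.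
rewrite c10E.
move: sh; move: (N`!) (M ^_ 10) (N ^_ 10) ((N - 10) ^_ 10) ((M - 10) ^_ 10) => f x y z t sh.
rewrite [X in X <= _](_ : _ = f * f * x * y * (t * y)); last by ring.
rewrite [X in _ <= X](_ : _ = f * f * x * y * (x * z)); last by ring.
by rewrite leq_mul2l sh orbT.
Qed.

Lemma c10_lower : N`! * M ^ 10 <= a * c10 * N ^ 10.
Proof.
apply: (@leq_trans (a * (c10 * N ^_ 10))).
  by rewrite c10E mulnCA leq_mul2l Ma orbT.
by rewrite -[X in _ <= X]mulnA; apply: leq_mul (leq_mul (leqnn _) (ffact_le_expn _ _)).
Qed.

(** Shared edges raise the joint probability by at most [(N / M) ^ eJ J], which [dens] bounds in
    terms of [m ^ #|J|]. Replacing powers by the exact [c10] costs a factor [a] for each copy. *)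
Lemma pcnt_agree (phi psi : fn) : agree phi psi != set0 ->
  s * (N`! * pcnt B (es phi :|: es psi)) <= a * a * c3 * (m ^ #|agree phi psi| * c10 ^ 2).
Proof.
move=> J0; set J := agree phi psi in J0 *.
have v0 : 0 < #|J| by rewrite card_gt0.
have v7 : #|J| <= 7 by have := max_card (mem J); rewrite card_ord.
have e10 : eJ J <= 10 by rewrite -size_DDo count_size.
have d := dens (eJ_dense J) v0 v7.
have [/= cU _] := andP (card_esetU mn phi psi); rewrite -/J in cU.
have NN : #|early n M| <= N by rewrite card_early.
have h := pcnt_le NN cU; rewrite card_early // in h.
have N0 : 0 < N ^ 20 by rewrite expn_gt0; apply/orP; left; apply: leq_trans N20.
rewrite -(leq_pmul2r N0).
have e20 : 20 = (20 - eJ J) + eJ J by move: e10; clear; lia.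
have EN : N ^ 20 = N ^ (20 - eJ J) * N ^ eJ J by rewrite {1}e20 expnD.
have EM : M ^ 20 = M ^ (20 - eJ J) * M ^ eJ J by rewrite {1}e20 expnD.
have h2 := leq_mul h d.
have h3 := leq_mul c10_lower c10_lower.
apply: (@leq_trans (c3 * m ^ #|J| * ((N`! * M ^ 10) * (N`! * M ^ 10)))).
  have -> : c3 * m ^ #|J| * (N`! * M ^ 10 * (N`! * M ^ 10)) =
      N`! * (N`! * M ^ (20 - eJ J) * (c3 * (m ^ #|J| * M ^ eJ J))).
    have : M ^ 10 * M ^ 10 = M ^ 20 by rewrite -expnD.
    rewrite EM; move: (M ^ 10) (M ^ (20 - eJ J)) (M ^ eJ J) (N`!) (m ^ #|J|) => x y z f g E.
    by transitivity (c3 * g * f * f * (x * x)); [ring|rewrite E; ring].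
  rewrite EN; move: h2; move: (N ^ (20 - eJ J)) (N ^ eJ J) (N`!) (pcnt _ _) => x y f g.
  move=> h2; rewrite [X in X <= _](_ : _ = f * (g * x * (s * y))); last by ring.
  by rewrite leq_mul2l h2 orbT.
apply: leq_trans (leq_mul (leqnn _) h3) _.
apply: eq_leq; have : N ^ 20 = N ^ 10 * N ^ 10 by rewrite -expnD.
by move=> ->; move: (N ^ 10) (m ^ #|J|) c10 => x y z; ring.
Qed.

Definition nb_copies (p : {perm K}) : nat := #|[set phi : fn | into B (es phi) p]|.

Lemma nb_copies_sum p : nb_copies p = \sum_(phi : fn) into B (es phi) p.
Proof. by rewrite /nb_copies cardsE -sum1_card big_mkcond. Qed.

Lemma sum_nb_copies : \sum_p nb_copies p = m ^ 7 * c10.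
Proof.
under eq_bigr do rewrite nb_copies_sum.
rewrite exchange_big /= (eq_bigr (fun=> c10)) => [|phi _]; last by rewrite -pcnt_sum pcnt_eset.
by rewrite sum_nat_const card_ffun !card_ord.
Qed.

Lemma sum_nb_copies2 : \sum_p nb_copies p ^ 2 = \sum_(phi : fn) \sum_(psi : fn) pcnt B (es phi :|: es psi).
Proof.
rewrite (eq_bigr (fun p => \sum_(phi : fn) \sum_(psi : fn) into B (es phi :|: es psi) p)).
  rewrite exchange_big /=; apply: eq_bigr => phi _.
  by rewrite exchange_big /=; apply: eq_bigr => psi _; rewrite -pcnt_sum.
move=> p _; rewrite nb_copies_sum -mulnn big_distrlr /=; apply: eq_bigr => phi _; apply: eq_bigr => psi _.
by rewrite into_setU mulnb.
Qed.

(** Placements agreeing nowhere contribute at most the squared mean, all others a fraction of order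
    [1 / s] of it; [2 ^ 7] comes from [sum_expn_agree]. The mean is at least 2 by [dens] for [DD]
    itself and [s_big]. *)
Lemma few_copies_bound : s * #|[set p | nb_copies p <= 1]| <= 4 * (2 ^ 7 * (a * a * c3)) * N`!.
Proof.
have mean : 2 * N`! <= m ^ 7 * c10.
  have ac : 0 < a * c3 by rewrite muln_gt0 a0.
  have N0 : 0 < N ^ 10 by rewrite expn_gt0; apply/orP; left; apply: leq_trans N20.
  rewrite -(leq_pmul2r ac) -(leq_pmul2r N0).
  have d := @dens 10 7 isT isT isT; have h := c10_lower.
  move: s_big d h; move: (N ^ 10) (M ^ 10) (N`!) (m ^ 7) c10 => x y f z c sb d h.
  apply: (@leq_trans (f * (s * x))).
    rewrite [X in X <= _](_ : _ = f * (2 * (a * c3) * x)); last by ring.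
    by rewrite !leq_mul2l leq_mul2r sb !orbT.
  apply: leq_trans (leq_mul (leqnn f) d) _.
  rewrite [X in X <= _](_ : _ = c3 * z * (f * y)); last by ring.
  rewrite [X in _ <= X](_ : _ = c3 * z * (a * c * x)); last by ring.
  by rewrite leq_mul2l h orbT.
rewrite -card_perm_type; apply: second_moment; rewrite sum_nb_copies ?card_perm_type //.
  by apply: leq_trans mean; rewrite muln_gt0 fact_gt0.
rewrite sum_nb_copies2 !big_distrr /=.
set k := a * a * c3.
apply: (@leq_trans (\sum_(phi : fn) (m ^ 7 * (s * c10 ^ 2) + k * c10 ^ 2 * (2 * m) ^ 7))).
  apply: leq_sum => phi _; rewrite !big_distrr /=.
  apply: (@leq_trans (\sum_(psi : fn) (s * c10 ^ 2 + k * c10 ^ 2 * m ^ #|agree phi psi|))).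
    apply: leq_sum => psi _; have [J0|J0] := eqVneq (agree phi psi) set0.
      by apply: leq_trans (leq_addr _ _); rewrite leq_mul2l pcnt_disagree ?orbT.
    apply: leq_trans (leq_addl _ _); rewrite -[X in _ <= X]mulnA [c10 ^ 2 * _]mulnC.
    exact: pcnt_agree.
  rewrite big_split /= sum_nat_const card_ffun !card_ord leq_add2l -big_distrr /=.
  by rewrite leq_mul2l sum_expn_agree orbT.
rewrite sum_nat_const card_ffun !card_ord expnMn; apply: eq_leq.
by move: (2 ^ 7) (m ^ 7) c10 => x y z; ring.
Qed.

Lemma few_copies p : ~~ contains_k_copies DD 2 (proc_graph p M) -> nb_copies p <= 1.
Proof.
apply: contraNT; rewrite -ltnNge => /card_gt1P[phi [psi [ip ip' ne]]].
by apply: (two_esets_contains ne (mn := mn)); [move: ip|move: ip']; rewrite inE.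
Qed.

End SecondMoment.

(** * The time [M] at which both estimates hold *)

Section Window.

(** Up to constants [n] is [s ^ al], [M] is [s ^ be] and the edge density is [s ^ (- ga)], so both
    probability estimates become linear inequalities between exponents, with the 1 providing a
    factor [s]. *)
Variables (al be ga : nat).
Hypotheses (al0 : 0 < al) (be0 : 0 < be) (ga0 : 0 < ga) (abg : be + ga = 2 * al).
Hypothesis union_exp : forall v, v < 24 -> al * v + 1 <= ga * kden v.
Hypothesis moment_exp : forall e v, 7 * e <= 10 * v -> 0 < v -> v <= 7 ->
  2 * al * e + 1 <= al * v + be * e.

Variables (n s : nat).
Hypotheses (s18 : 18 <= s) (sn : s ^ al <= n) (ns : n < s.+1 ^ al).
Local Notation K := (Kedge n).
Local Notation M := (s ^ be).
Local Notation c1 := (2 ^ al).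

(* The explicit constants only enter through these bounds: as variables they
   cannot be unfolded to unary numerals. *)
Variables (a c c2 c3 : nat).
Hypotheses (a_ge : 2 ^ 10 <= a) (c_ge : c1 ^ 23 * 4 ^ 33 <= c) (c2_ge : 2 ^ (23 * 23) <= c2).
Hypotheses (c3_ge : c1 ^ 20 * 14 ^ 7 <= c3) (c30 : 0 < c3) (s_big : 2 * (a * c3) <= s).

Lemma s_gt0 : 0 < s. Proof. exact: leq_trans s18. Qed.

Lemma leq_exp_self k : 0 < k -> s <= s ^ k.
Proof. by move=> k0; rewrite -{1}[s]expn1 leq_exp2l // (leq_trans _ s18). Qed.

Lemma n_ge18 : 18 <= n.
Proof. exact: leq_trans s18 (leq_trans (leq_exp_self al0) sn). Qed.

Lemma n_upper : n <= c1 * s ^ al.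
Proof.
rewrite -expnMn; apply: leq_trans (ltnW ns) _; rewrite leq_exp2r //.
by rewrite mul2n -addnn -addn1 leq_add2l s_gt0.
Qed.

Lemma nn_le_4K : n * n <= 4 * #|K|.
Proof.
have h := card_Kedge_ge n; have : 2 * n <= n * n.
  by rewrite leq_mul2r (leq_trans _ n_ge18) ?orbT.
by move: h; move: (n * n) #|Kedge n| => x y; clear; lia.
Qed.

Lemma s2al_le : s ^ (2 * al) <= 4 * #|K|.
Proof. by apply: leq_trans nn_le_4K; rewrite mul2n -addnn expnD leq_mul. Qed.

Lemma M_le : M <= #|K|.
Proof.
rewrite -(leq_pmul2l (isT : 0 < 4)); apply: leq_trans s2al_le.
rewrite -abg expnD mulnC leq_mul2l; apply/orP; right.
by apply: leq_trans (leq_exp_self ga0); apply: leq_trans s18.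
Qed.

Lemma K_ge20 : 20 <= #|K|.
Proof.
have h := nn_le_4K; have : 18 * 18 <= n * n by apply: leq_mul; exact: n_ge18.
by move: h; move: (n * n) #|Kedge n| => x y; clear; lia.
Qed.

Lemma union_bound v : v < 24 ->
  n ^ v * M ^ kden v * s <= c * #|K| ^ kden v.
Proof.
move=> v24; set k := kden v.
(* The largest case is [v = 23], where [kden 23 = 33]. *)
have k33 : k <= 33 by rewrite /k /kden; move: v24; clear; lia.
have c10 : 0 < c1 by rewrite expn_gt0.
have hn : n ^ v <= c1 ^ v * s ^ (al * v).
  rewrite expnM -expnMn; case: (v) => // v'; rewrite leq_exp2r //; exact: n_upper.
apply: (@leq_trans (c1 ^ v * (s ^ (al * v + 1) * M ^ k))).
  rewrite addn1 expnSr; move: hn; move: (n ^ v) (M ^ k) (c1 ^ v) (s ^ (al * v)) => x y z t hn.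
  rewrite [X in X <= _](_ : _ = y * s * x); last by ring.
  rewrite [X in _ <= X](_ : _ = y * s * (z * t)); last by ring.
  by rewrite leq_mul2l hn orbT.
have h2 : s ^ (al * v + 1) * M ^ k <= 4 ^ k * #|K| ^ k.
  apply: (@leq_trans (s ^ (ga * k) * M ^ k)).
    by rewrite leq_mul2r leq_pexp2l ?s_gt0 ?orbT //; apply: union_exp.
  rewrite expnM -!expnMn -expnD addnC abg.
  by case: (k) => // k'; rewrite leq_exp2r // s2al_le.
apply: leq_trans (leq_mul (leqnn _) h2) _; rewrite mulnA leq_mul2r; apply/orP; right.
by apply: leq_trans c_ge; apply: leq_mul; rewrite leq_pexp2l.
Qed.

Lemma block_bounds : [/\ 0 < n %/ 7, 7 * (n %/ 7) <= n & n <= 14 * (n %/ 7)].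
Proof. by have := n_ge18; clear; split; lia. Qed.

Lemma moment_bound e v : 7 * e <= 10 * v -> 0 < v -> v <= 7 ->
  s * #|K| ^ e <= c3 * ((n %/ 7) ^ v * M ^ e).
Proof.
move=> ev v0 v7; have e10 : e <= 10 by move: ev v7; clear; lia.
have c10 : 0 < c1 by rewrite expn_gt0.
have [m0 _ m14] := block_bounds.
have hN : #|K| ^ e <= c1 ^ (2 * e) * s ^ (2 * al * e).
  rewrite (expnM s (2 * al)) (expnM c1) -expnMn; case: (e) => // e'; rewrite leq_exp2r //.
  apply: leq_trans (card_Kedge_le n) _.
  by rewrite [2 * al]mulnC expnM -!mulnn mulnACA; apply: leq_mul; exact: n_upper.
apply: (@leq_trans (c1 ^ (2 * e) * s ^ (2 * al * e + 1))).
  rewrite addn1 expnS; move: hN; move: (#|K| ^ e) (c1 ^ _) (s ^ (2 * al * e)) => x y z hN.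
  by rewrite mulnCA leq_mul2l hN orbT.
have h2 : s ^ (2 * al * e + 1) <= 14 ^ v * ((n %/ 7) ^ v * M ^ e).
  apply: (@leq_trans (s ^ (al * v + be * e))).
    by rewrite leq_pexp2l ?s_gt0 //; apply: moment_exp.
  rewrite expnD !expnM mulnA -expnMn leq_mul2r; apply/orP; right.
  by rewrite leq_exp2r //; apply: leq_trans sn m14.
apply: leq_trans (leq_mul (leqnn _) h2) _; rewrite mulnA leq_mul2r; apply/orP; right.
(* The exponents come from at most 10 edges, counted twice since [#|K|] is quadratic in [n], and at
   most 7 vertices; 14 bounds [n / (n %/ 7)]. *)
apply: leq_trans c3_ge; apply: leq_mul; rewrite leq_pexp2l //.
by rewrite -[20]/(2 * 10) leq_mul2l e10 orbT.
Qed.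

Definition good (p : {perm K}) : bool :=
  sparse (proc_graph p M) && contains_k_copies DD 2 (proc_graph p M).

Lemma bad_bound : s * #|[set p | ~~ good p]| <=
  (24 * (c2 * c) + 4 * (2 ^ 7 * (a * a * c3))) * #|K|`!.
Proof.
have [m0 mn _] := block_bounds.
have M18 : 18 <= M by apply: leq_trans s18 (leq_exp_self be0).
have Ma : M ^ 10 <= a * M ^_ 10.
  by apply: leq_trans (ffact10_lower M18) _; rewrite leq_mul2r a_ge orbT.
have a0 : 0 < a by apply: leq_trans a_ge; rewrite expn_gt0.
have h1 := not_sparse_bound (leq_trans _ n_ge18) (leq_trans _ K_ge20) M_le union_bound.
have {}h1 := leq_trans (h1 isT isT) (leq_mul (leqnn 24) (leq_mul c2_ge (leqnn _))).
have h2 := few_copies_bound m0 mn M_le K_ge20 Ma moment_bound c30 a0 s_big.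
rewrite mulnDl [24 * (c2 * c) * _]mulnAC -[24 * _ * _]mulnA [_ * (c2 * c)]mulnC -[c2 * c * _]mulnA.
apply: leq_trans (leq_add h1 h2); rewrite -mulnDr leq_mul2l; apply/orP; right.
apply: leq_trans (leq_card_setU _ _).1; apply/subset_leq_card/subsetP=> p.
by rewrite in_set negb_and in_setU !in_set => /orP[-> //|/(few_copies mn) ->]; rewrite orbT.
Qed.

End Window.

(** * Hitting times *)

(** The first success occurs by time [M], and up to then the predicates agree. *)
Lemma find_iota_eq (a b : pred nat) M N : M <= N -> (forall i, i <= M -> a i = b i) ->
  b M -> find a (iota 0 N.+1) = find b (iota 0 N.+1).
Proof.
move=> MN ab bM; rewrite -(subnKC MN) -addSn iotaD !find_cat.
have E : {in iota 0 M.+1, a =1 b} by move=> i; rewrite mem_iota => /ab.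
rewrite (eq_in_has E) (eq_in_find E).
suff -> : has b (iota 0 M.+1) by [].
by apply/hasP; exists M => //; rewrite mem_iota /=.
Qed.

(** Sparseness passes to earlier graphs of the process, so the game is decided by copies of [DD] at
    all times up to [M]. *)
Lemma good_hitting n (p : {perm Kedge n}) M : M <= #|Kedge n| ->
  sparse (proc_graph p M) -> contains_k_copies DD 2 (proc_graph p M) ->
  hitting_time (@EA_K3 _) p = hitting_time (contains_k_copies DD 1) p /\
  hitting_time (@EE_K3 _) p = hitting_time (contains_k_copies DD 2) p.
Proof.
move=> MK sp c2.
have spi i : i <= M -> sparse (proc_graph p i).
  by move=> iM; apply: sub_sparse sp => x y; apply: proc_graph_mono.
have [sy ir] := (@proc_graph_sym n p, @proc_graph_irr n p).
split; apply: (find_iota_eq MK) => [i /spi spi'|] //.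
- exact: sparse_EA.
- exact: sub_contains_2 c2.
- exact: sparse_EE.
Qed.

Lemma nat_root al s0 n : 0 < al -> s0 ^ al <= n ->
  exists s, [/\ s0 <= s, s ^ al <= n & n < s.+1 ^ al].
Proof.
move=> al0 h.
have ub i : i ^ al <= n -> i <= n.
  apply: leq_trans; case: i => // i.
  by rewrite -{1}[i.+1]expn1 leq_pexp2l.
case: (ex_maxnP (ex_intro (fun i => i ^ al <= n) s0 h) ub) => s sn max.
exists s; split=> //; first exact: max.
by rewrite ltnNge; apply/negP=> /max; rewrite ltnn.
Qed.

(** Destructing this replaces a huge constant by a variable that is never evaluated. *)
Lemma exists_leq (x : nat) : exists c, x <= c.
Proof. by exists x. Qed.

Lemma hitting_times_window : exists al C s0, 0 < al /\
  forall s n, s0 <= s -> s ^ al <= n -> n < s.+1 ^ al ->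
  exists2 G : {set {perm Kedge n}},
    (forall p, p \in G ->
      hitting_time (@EA_K3 _) p = hitting_time (contains_k_copies DD 1) p /\
      hitting_time (@EE_K3 _) p = hitting_time (contains_k_copies DD 2) p) &
    s * #|~: G| <= C * #|{perm Kedge n}|.
Proof.
have [al [be [ga [al0 be0 ga0 [abg ue me]]]]] : exists al be ga,
    [/\ 0 < al, 0 < be, 0 < ga & [/\ be + ga = 2 * al,
     forall v, v < 24 -> al * v + 1 <= ga * kden v &
     forall e v, 7 * e <= 10 * v -> 0 < v -> v <= 7 -> 2 * al * e + 1 <= al * v + be * e]].
  (* n = s^340 and M = s^443 = n^(13/10 + 1/340), so M / n^2 = s^(-237). *)
  exists 340, 443, 237; split=> //; split=> // [v|e v]; rewrite /kden; lia.
have [a a_ge] := exists_leq (2 ^ 10).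
have [c c_ge] := exists_leq ((2 ^ al) ^ 23 * 4 ^ 33).
have [c2 c2_ge] := exists_leq (2 ^ (23 * 23)).
have [c3 c3_ge] := exists_leq ((2 ^ al) ^ 20 * 14 ^ 7).
have c30 : 0 < c3 by apply: leq_trans c3_ge; rewrite muln_gt0 !expn_gt0.
exists al, (24 * (c2 * c) + 4 * (2 ^ 7 * (a * a * c3))), (18 + 2 * (a * c3)).
split=> // s n s0s sn ns.
have s18 : 18 <= s by apply: leq_trans s0s; apply: leq_addr.
have s_big : 2 * (a * c3) <= s by apply: leq_trans s0s; apply: leq_addl.
have bad := bad_bound al0 be0 ga0 abg ue me s18 sn ns a_ge c_ge c2_ge c3_ge c30 s_big.
exists [set p | good be s p].
  move=> p; rewrite inE => /andP[]; apply: good_hitting.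
  exact: (M_le al0 ga0 abg s18 sn).
rewrite card_perm_type; apply: leq_trans bad; rewrite leq_mul2l; apply/orP; right.
by apply/subset_leq_card/subsetP=> p; rewrite !inE.
Qed.

Theorem theorem7 :
  whp (fun n p => hitting_time (@EA_K3 _) p
                  == hitting_time (contains_k_copies DD 1) p) /\
  whp (fun n p => hitting_time (@EE_K3 _) p
                  == hitting_time (contains_k_copies DD 2) p).
Proof.
have [al [C [s0 [al0 window]]]] := hitting_times_window.
(* One set of good permutations serves both orders of play. *)
suff main : forall eps : rat, (0 < eps)%R -> exists N, forall n, N <= n ->
    exists2 G : {set {perm Kedge n}},
      (forall p, p \in G ->
        hitting_time (@EA_K3 _) p = hitting_time (contains_k_copies DD 1) p /\
        hitting_time (@EE_K3 _) p = hitting_time (contains_k_copies DD 2) p) &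
      (1 - eps <= #|G|%:R / #|{perm Kedge n}|%:R)%R.
  have perm0 n : (0 < (#|{perm Kedge n}|%:R)^-1 :> rat)%R.
    by rewrite invr_gt0 ltr0n card_perm_type fact_gt0.
  split=> eps /main[N H]; exists N => n /H[G HG]; move/Order.POrderTheory.le_trans; apply;
    rewrite ler_pM2r // ler_nat; apply/subset_leq_card/subsetP=> p /HG[E E'];
    by rewrite inE ?E ?E'.
move=> eps eps0.
(* From here on the integer root [s] of [n] is at least [s0] and exceeds [C / eps], so that
   [C / s < eps]. *)
exists ((s0 + Num.bound (C%:R / eps)%R).+1 ^ al) => n /(nat_root al0)[s [s0s sn ns]].
have [|G HG CW] := window s n _ sn ns.
  by apply: leq_trans s0s; rewrite -addnS leq_addr.
exists G => //.
have sC : (C%:R / eps < s%:R :> rat)%R.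
  apply: Order.POrderTheory.lt_le_trans (archi_boundP _) _.
    by rewrite divr_ge0 ?ler0n // Order.POrderTheory.ltW.
  by rewrite ler_nat; apply: leq_trans s0s; rewrite -addSn leq_addl.
have W0 : (0 < #|{perm Kedge n}|%:R :> rat)%R by rewrite ltr0n card_perm_type fact_gt0.
rewrite ler_pdivlMr // -(cardsC G) natrD.
rewrite -(cardsC G) -(ler_nat rat) !natrM natrD in CW.
move: CW; set g : rat := (#|G|%:R)%R; set b : rat := (#|~: G|%:R)%R => CW.
have [g0 b0] : (0 <= g)%R /\ (0 <= b)%R by split; apply: ler0n.
rewrite ltr_pdivrMr // in sC.
have s_gt : (0 < s%:R :> rat)%R by rewrite ltr0n; apply: leq_trans s0s.
suff : (b <= eps * (g + b))%R by lra.
rewrite -(ler_pM2l s_gt); apply: (Order.POrderTheory.le_trans CW).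
rewrite mulrA; apply: ler_wpM2r; first by rewrite addr_ge0.
by rewrite Order.POrderTheory.ltW.
Qed.
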